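(* For any $n_0\in\{\underline n,\ldots,\overline n\}$, consider the problem $Z_c(n_0)=\sup\{S_c(d): n_0(d)=n_0\}$, with optimal single quote denoted $d^{S_c}_{n_0}$, and let $a_c$ (depending on $n_0$) be as defined in the context. There are the following cases: (i) If $a_c(\tilde d^P_{n_0})\le0$, then either $d^{S_c}_{\overline n}=0$, or there is no optimal single lead-time quote such that $n_0(d)=n_0$, i.e. the supremum is not attained by any $d\in(\tilde d^P_{n_0},\tilde d^P_{n_0-1}]$. In the second case there exist $\epsilon$-optimal lead-time quotes. (ii) If $a_c(\tilde d^P_{n_0-1})\ge0$, then $d^{S_c}_{n_0}=\tilde d^P_{n_0-1}<\infty$ is the unique optimal lead-time quote. (iii) Otherwise $d^{S_c}_{n_0}<\infty$ is the unique solution of $a_c(d)=0$ in $(\tilde d^P_{n_0},\tilde d^P_{n_0-1}]$.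
   Context: Parameters: $\lambda,\mu>0$ (arrival and service rates of an observable M/M/1 system), $\rho=\lambda/\mu$; service value $R$, entrance fee $p$, waiting cost rate $c>0$, compensation rate $l$, risk-aversion coefficient $r>0$, with $0\le p\le R$ and $0\le l\le c$. For each integer $n\ge0$, $X_n\sim Gamma(n+1,\mu)$ has density $\mu^{n+1}x^ne^{-\mu x}/n!$ on $(0,\infty)$. A lead-time quote is $d\in[0,\infty]$; $d=\infty$ means no compensation, with $(x-\infty)^+=0$. Expected utility of a joining customer who finds $n$ customers and is quoted $d$: $$B_n(d)=E\left[\frac{1-e^{-r(R-p-cX_n+l(X_n-d)^+)}}{r}\right]\in[-\infty,\infty).$$ It is $-\infty$ for all $n,d$ if $\mu\le r(c-l)$. The customer joins iff $B_n(d)\ge 0$. Let $L_n(d)=E(X_n-d)^+$, and let $G_n(d)=p-lL_n(d)$ if $B_n(d)\ge0$, $G_n(d)=0$ if $B_n(d)<0$. Put $\underline n=\inf\{n\ge0:\lim_{d\to\infty}B_n(d)<0\}$, $\overline n=\inf\{n\ge0:B_n(0)<0\}$ (with $\inf\varnothing=\infty$), $q(n;n_0)=\rho^n/\sum_{k=0}^{n_0}\rho^k$ for $0\le n\le n_0$, and $\tilde d^P_n=\sup\{d\ge0:B_n(d)\ge0\}$ with $\sup\varnothing=-1$; also $\tilde d^P_{\underline n-1}=\infty$. The same quote $d$ is offered in all states; its balking threshold is $n_0(d)=\min\{n\ge0:B_n(d)<0\}$ and its social benefit per unit time is $S_c(d)=\lambda\sum_{n=0}^{n_0(d)-1}q(n;n_0(d))(G_n(d)+B_n(d))$.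 A quote with $n_0(d)=n_0$ is optimal for $n_0$ if $S_c(d)=Z_c(n_0)$; ''$\epsilon$-optimal quotes exist'' means that quotes with $n_0(d)=n_0$ approach the supremum $Z_c(n_0)$ arbitrarily closely. Let $v=\mu-r(c-l)$. For $\theta\in\{\mu,v\}$ let $\overline F_\theta(d)=P(X>d)$, where $X$ is the sojourn time of a customer in a finite capacity $M/M/1/n_0$ queue with arrival rate $\lambda$ and service rate $\theta$ in steady state. Let $$\beta=\left(\frac{\mu-\lambda}{1-\rho^{n_0+1}}\right)\left(\frac{1-(\lambda/v)^{n_0+1}}{v-\lambda}\right)$$ and $$a_c(d)=\frac{\overline F_\mu(d)}{\overline F_v(d)}e^{-rld}-\beta e^{-r(R-p)},$$ with $a_c(\infty)$ understood as the limit as $d\to\infty$.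
   Formalization: Excluded: n_0=0 (a_c is 0/0) and l=c with p=R (no quote has n_0(d)=n_0≥1, yet a_c=0 would trigger (ii)). Blocked customers add nothing to P(X>d), also at d=-1; β is extended continuously at λ=μ, λ=v; for l=0 the optimum is not claimed unique. *)

(* Defs.v *)
From HB Require Import structures.
From mathcomp Require Import all_boot all_order all_algebra.
From mathcomp Require Import all_classical all_reals all_analysis.

Set Implicit Arguments.
Unset Strict Implicit.
Unset Printing Implicit Defensive.

Import Order.TTheory GRing.Theory Num.Theory.
Import numFieldNormedType.Exports.

Local Open Scope classical_set_scope.
Local Open Scope ring_scope.

(* [lam], [mu]: arrival and service rates; [reward]: service value (R);
   [fee]: entrance fee (p); [cwait]: waiting cost rate (c);
   [lcomp]: compensation rate (l); [risk]: risk aversion (r). *)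
Record model (R : realType) := Model {
  lam : R; mu : R; reward : R; fee : R; cwait : R; lcomp : R; risk : R }.

(* The least element of {n | P n}; [None] encodes inf of the empty set = oo. *)
Definition first_nat (P : pred nat) : option nat :=
  if pselect (exists n, P n) is left exP then Some (ex_minn exP) else None.

Definition onat_ereal (R : realType) (o : option nat) : \bar R :=
  if o is Some n then n%:R%:E else +oo%E.

Definition gamma_pdf (R : realType) (n : nat) (theta x : R) : R :=
  theta ^+ n.+1 * x ^+ n * expR (- (theta * x)) / (n`!)%:R.

(* E[f(X)] for X ~ Gamma(n+1, theta). *)
Definition Egamma (R : realType) (n : nat) (theta : R) (f : R -> R) : \bar R :=
  (\int[@lebesgue_measure R]_(x in `]0%R, +oo[) (f x * gamma_pdf n theta x)%:E)%E.

(* (x - d)^+ for a quote d in [0, +oo]; the extended subtraction makes it 0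
   when d = +oo. *)
Definition delay (R : realType) (x : R) (d : \bar R) : R :=
  fine (Order.max (x%:E - d)%E 0%E).

(* q(n; n0) with traffic intensity [rho]. *)
Definition qst (R : realType) (rho : R) (n n0 : nat) : R :=
  rho ^+ n / \sum_(k < n0.+1) rho ^+ k.

(* P(X > d) for the sojourn time X of an arriving customer in the stationary
   M/M/1/n0 queue (at most n0 customers in the system) with arrival rate [la]
   and service rate [theta].  The customer finds n customers with probability
   q(n; n0), and then stays a Gamma(n+1, theta) time if n < n0.  For n = n0 he
   is blocked: he has no sojourn, and does not contribute to {X > d} for any d
   (for d >= 0 this is the same as setting X = 0). *)
Definition sojourn_tail (R : realType) (la theta : R) (n0 : nat) (d : R) : R :=
  \sum_(n < n0) qst (la / theta) n n0 *
    fine (Egamma n theta (\1_(`]d, +oo[%classic : set R))).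

Section Model.
Context (R : realType) (M : model R).

Definition rho : R := lam M / mu M.

Definition vrate : R := mu M - risk M * (cwait M - lcomp M).

Definition B (n : nat) (d : \bar R) : \bar R :=
  Egamma n (mu M) (fun x =>
    (1 - expR (- (risk M *
           (reward M - fee M - cwait M * x + lcomp M * delay x d)))) / risk M).

Definition L (n : nat) (d : \bar R) : \bar R :=
  Egamma n (mu M) (fun x => delay x d).

Definition G (n : nat) (d : \bar R) : \bar R :=
  if (0 <= B n d)%E then ((fee M)%:E - (lcomp M)%:E * L n d)%E else 0%E.

Definition nlow : option nat :=
  first_nat (fun n => (lim (B n d%:E @[d --> +oo%R]) < 0)%E).

Definition nhigh : option nat := first_nat (fun n => (B n 0 < 0)%E).

(* The thresholds \tilde d^P_n; -1 is the convention for sup of the empty set. *)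
Definition dP (n : nat) : \bar R :=
  let A := [set d : \bar R | (0 <= d)%E /\ (0 <= B n d)%E] in
  if `[< A = set0 >] then (-1)%:E else ereal_sup A.

(* \tilde d^P_{n-1}, including the convention \tilde d^P_{nlow-1} = +oo. *)
Definition dP_pred (n : nat) : \bar R :=
  if nlow == Some n then +oo%E else dP n.-1.

(* n_0(d) *)
Definition balk (d : \bar R) : option nat :=
  first_nat (fun n => (B n d < 0)%E).

(* The value 0 when n_0(d) = oo is a placeholder: such quotes are never
   compared. *)
Definition Sc (d : \bar R) : \bar R :=
  if balk d is Some m then
    ((lam M)%:E * \sum_(n < m) (qst rho n m)%:E * (G n d + B n d))%E
  else 0%E.

Definition feasible (n0 : nat) : set (\bar R) :=
  [set d | (0 <= d)%E /\ balk d = Some n0].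

Definition Zc (n0 : nat) : \bar R := ereal_sup [set Sc d | d in feasible n0].

Definition optimal (n0 : nat) (d : \bar R) : Prop :=
  feasible n0 d /\ Sc d = Zc n0.

Definition eps_optimal_exist (n0 : nat) : Prop :=
  forall e : R, 0 < e ->
    exists2 d, feasible n0 d & (Zc n0 - e%:E < Sc d)%E.

(* "d is d^{S_c}_{n0}", the optimal single quote for n0.  The definite article
   makes sense only for l > 0: when l = 0, S_c does not depend on the quote. *)
Definition is_dSc (n0 : nat) (d : \bar R) : Prop :=
  optimal n0 d /\ (0 < lcomp M -> forall d', optimal n0 d' -> d' = d).

(* ((mu - lam) / (1 - rho^(n0+1))) * ((1 - (lam/v)^(n0+1)) / (v - lam)), each
   factor being extended by continuity where it reads 0 / 0. *)
Definition beta_c (n0 : nat) : R :=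
  (if lam M == mu M then mu M / n0.+1%:R
   else (mu M - lam M) / (1 - rho ^+ n0.+1)) *
  (if lam M == vrate then n0.+1%:R / vrate
   else (1 - (lam M / vrate) ^+ n0.+1) / (vrate - lam M)).

Definition a_c_fin (n0 : nat) (d : R) : R :=
  sojourn_tail (lam M) (mu M) n0 d / sojourn_tail (lam M) vrate n0 d
    * expR (- (risk M * lcomp M * d))
  - beta_c n0 * expR (- (risk M * (reward M - fee M))).

(* The value at -oo is a placeholder. *)
Definition a_c (n0 : nat) (d : \bar R) : R :=
  match d with
  | x%:E => a_c_fin n0 x
  | +oo%E => lim (a_c_fin n0 x @[x --> +oo%R])
  | -oo%E => 0
  end.

End Model.

(* Main.v *)
Require Import Defs.
From HB Require Import structures.
From mathcomp Require Import all_boot all_order all_algebra.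
From mathcomp Require Import all_classical all_reals all_analysis.
From mathcomp Require Import measurable_realfun ring lra.
Set Implicit Arguments.
Unset Strict Implicit.
Unset Printing Implicit Defensive.
Import Order.TTheory GRing.Theory Num.Theory.
Import numFieldNormedType.Exports.
Local Open Scope classical_set_scope.
Local Open Scope ring_scope.

(** The case distinction is the sign of a derivative.  Fix the balking
    threshold n0.  While the quote d has this threshold, every state n < n0 is
    joined, so S_c is an explicit smooth function of d, and differentiating the
    fee, the expected compensation and the expected utility in d gives

      S_c'(d) = lambda l e^(r l d) F_v(d) a_c(d)

    ([is_derive_welfare]).  Two facts enter.  First, the derivative of an
    exponential utility tilts the Gamma(n+1, mu) law into the Gamma(n+1, v) law
    multiplied by (mu/v)^(n+1), which is where the second service rate v comes
    from.  Second, the factor left over when the mixtures over n are rewritten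
    as sojourn tails of M/M/1/n0 queues with rates mu and v is exactly beta_c
    ([beta_cE]).

    Next, a_c is strictly decreasing on [0, oo[ ([a_c_fin_decr]) with a negative
    limit ([a_c_infty_lt0]), so S_c is unimodal, and constant if l = 0.  Up to
    normalization the sojourn density for the rate theta is
    theta e^(-theta d) E(lambda d), where the polynomial E, a truncated
    exponential series, is the same for all theta.  Hence the hazard rates of the two queues are compared through their
    Mills ratios, tail over density, which up to the common factor E are sums
    of monomials in 1/theta with nonnegative coefficients ([tail_ratio_nincr],
    [tail_ratio_decr]).  The same comparison bounds F_mu / F_v by a multiple
    of e^(-(mu - v) d), which gives the limit.

    Finally, the quotes with threshold n0 form the interval
    ]d_n0, d_(n0-1)] cut at 0 ([feasibleP]), since the utility decreases in
    both d and n, and this interval is never empty ([dP_lt_pred]).  The three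
    cases are then: S_c decreasing on the interval (its maximum is at 0 if 0
    belongs to it, and otherwise its supremum sits at the excluded left end),
    S_c increasing up to the included right end, and S_c increasing and then
    decreasing.

    Two boundary effects need care.  When the interval starts at 0, a_c is
    evaluated at the conventional left end -1; there the third case still
    yields a zero in [0, oo[, because a_c(0) is a positive multiple of a sum of
    the nonnegative utilities at quote 0 ([a_c_fin0_ge0]).  The quote +oo can
    be feasible as well; its welfare is the limit of the welfare of finite
    quotes ([Sc_feasible_infty]), and it is never optimal when l > 0. *)

(** * Monotonicity from derivatives *)

Section Calculus.
Context {R : realType}.
Implicit Types (f df : R -> R) (a b x : R).

Lemma is_derive_continuous f df :
  (forall x, is_derive x 1 f (df x)) -> continuous f.
Proof.
move=> fdf x; apply: differentiable_continuous.
by apply/derivable1_diffP; case: (fdf x).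
Qed.

Lemma mean_value f df a b :
  (forall x, a <= x <= b -> is_derive x 1 f (df x)) -> a < b ->
  exists2 c, a < c < b & f b - f a = df c * (b - a).
Proof.
move=> fdf ab.
have cf : {within `[a, b], continuous f}.
  apply: derivable_within_continuous => x; rewrite in_itv/= => xab.
  by case: (fdf x xab).
have dfo x : x \in `]a, b[ -> is_derive x 1 f (df x).
  by rewrite in_itv/= => /andP[/ltW ax /ltW xb]; apply: fdf; rewrite ax.
have [c cab ->] := MVT ab dfo cf.
by exists c => //; move: cab; rewrite in_itv.
Qed.

Lemma is_derive_ltr f df a b :
  (forall x, a <= x <= b -> is_derive x 1 f (df x)) -> a < b ->
  (forall x, a < x < b -> 0 < df x) -> f a < f b.
Proof.
move=> fdf ab df0; have [c cab e] := mean_value fdf ab.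
by rewrite -subr_gt0 e mulr_gt0 ?df0 ?subr_gt0.
Qed.

Lemma is_derive_ler f df a b :
  (forall x, a <= x <= b -> is_derive x 1 f (df x)) -> a <= b ->
  (forall x, a < x < b -> 0 <= df x) -> f a <= f b.
Proof.
move=> fdf; rewrite le_eqVlt => /predU1P[->//|ab] df0.
have [c cab e] := mean_value fdf ab.
by rewrite -subr_ge0 e mulr_ge0 ?df0 // subr_ge0 ltW.
Qed.

Lemma is_derive_gtr f df a b :
  (forall x, a <= x <= b -> is_derive x 1 f (df x)) -> a < b ->
  (forall x, a < x < b -> df x < 0) -> f b < f a.
Proof.
move=> fdf ab df0; have [c cab e] := mean_value fdf ab.
by rewrite -subr_lt0 e nmulr_rlt0 ?df0 ?subr_gt0.
Qed.

Lemma is_derive_ger f df a b :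
  (forall x, a <= x <= b -> is_derive x 1 f (df x)) -> a <= b ->
  (forall x, a < x < b -> df x <= 0) -> f b <= f a.
Proof.
move=> fdf; rewrite le_eqVlt => /predU1P[->//|ab] df0.
have [c cab e] := mean_value fdf ab.
by rewrite -subr_le0 e mulr_le0_ge0 ?df0 // subr_ge0 ltW.
Qed.

Lemma is_derive_expRM k x : is_derive x 1 (fun y => expR (k * y)) (k * expR (k * x)).
Proof.
have h : is_derive x 1 (fun y : R => k * y) k.
  by apply: is_derive_eq; rewrite /GRing.scale /= mulr1.
have := @is_derive1_comp R expR (fun y => k * y) x _ _ (is_derive_expR _) h.
by rewrite mulrC.
Qed.

Lemma is_derive_exprn n x : is_derive x 1 (fun y => y ^+ n) (n%:R * x ^+ n.-1).
Proof.
have := @is_deriveX R _ id n x 1 1 (is_derive_id _ _).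
rewrite /GRing.scale /= mulr1 => h.
by rewrite (_ : (fun y : R => y ^+ n) = id ^+ n) //; apply/funext => y; rewrite fctE.
Qed.

End Calculus.

(** * Tails of Gamma laws *)

Section GammaTail.
Context {R : realType}.
Implicit Types (n : nat) (theta k x : R).

(** The probability that a Gamma(n+1, theta) variable exceeds x, in Poisson
    form; as a formula it makes sense, and is differentiable, at every real x,
    which spares one-sided derivatives at 0. *)
Definition gamma_tail n theta x : R :=
  expR (- (theta * x)) * \sum_(k < n.+1) (theta * x) ^+ k / (k`!)%:R.

Lemma gamma_tail_recr n theta x : gamma_tail n.+1 theta x =
  gamma_tail n theta x
  + expR (- (theta * x)) * (theta * x) ^+ n.+1 / (n.+1`!)%:R.
Proof. by rewrite /gamma_tail big_ord_recr /= mulrDr mulrA. Qed.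

Lemma gamma_tailE0 n theta : gamma_tail n theta 0 = 1.
Proof.
rewrite /gamma_tail mulr0 oppr0 expR0 mul1r big_ord_recl /= expr0 fact0 divr1.
by rewrite big1 ?addr0// => i _; rewrite exprS mul0r mul0r.
Qed.

Lemma gamma_tail_gt0 n theta x : 0 <= theta -> 0 <= x -> 0 < gamma_tail n theta x.
Proof.
move=> theta0 x0; rewrite /gamma_tail mulr_gt0 ?expR_gt0//.
rewrite big_ord_recl /= expr0 fact0 divr1 ltr_pwDl// sumr_ge0// => i _.
by rewrite divr_ge0// exprn_ge0// mulr_ge0.
Qed.

Lemma gamma_tail_ge0 n theta x : 0 <= theta -> 0 <= x -> 0 <= gamma_tail n theta x.
Proof. by move=> theta0 x0; rewrite ltW// gamma_tail_gt0. Qed.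

Lemma gamma_tail_le n theta x : 0 <= theta -> 0 <= x ->
  gamma_tail n theta x <= gamma_tail n.+1 theta x.
Proof.
move=> theta0 x0; rewrite gamma_tail_recr lerDl.
by rewrite divr_ge0// mulr_ge0 ?expR_ge0// exprn_ge0// mulr_ge0.
Qed.

Lemma gamma_tail_lt n theta x : 0 < theta -> 0 < x ->
  gamma_tail n theta x < gamma_tail n.+1 theta x.
Proof.
move=> theta0 x0; rewrite gamma_tail_recr ltrDl.
by rewrite divr_gt0 ?ltr0n ?fact_gt0// mulr_gt0 ?expR_gt0// exprn_gt0// mulr_gt0.
Qed.

(** By induction on n the sum telescopes: each new Poisson term contributes the
    difference of two consecutive Gamma densities. *)
Lemma is_derive_gamma_tail n theta x :
  is_derive x 1 (gamma_tail n theta) (- gamma_pdf n theta x).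
Proof.
have dexp (y : R) : is_derive y (1 : R) (fun y => expR (- (theta * y)))
    (- theta * expR (- (theta * y))).
  rewrite -(mulNr theta y) (_ : (fun _ => _) = fun y => expR (- theta * y)).
    exact: is_derive_expRM.
  by apply/funext => z; rewrite mulNr.
elim: n => [|n IHn].
  rewrite (_ : gamma_tail 0 theta = fun y => expR (- (theta * y))); last first.
    by apply/funext => y; rewrite /gamma_tail big_ord1 expr0 fact0 divr1 mulr1.
  apply: is_derive_eq.
  by rewrite /gamma_pdf expr1 expr0 fact0 divr1 mulr1 mulNr.
have nf0 : (n.+1`!)%:R != 0 :> R by rewrite pnatr_eq0 -lt0n fact_gt0.
have nf1 : (n`!)%:R != 0 :> R by rewrite pnatr_eq0 -lt0n fact_gt0.
have n1 : (n.+1)%:R != 0 :> R by rewrite pnatr_eq0.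
pose c := theta ^+ n.+1 / (n.+1`!)%:R.
have dx := is_derive_exprn n.+1 x.
have := is_deriveD IHn (is_deriveZ c (is_deriveM (dexp x) dx)).
rewrite (_ : _ + _ \*: _ = gamma_tail n.+1 theta); last first.
  apply/funext => y; rewrite gamma_tail_recr; congr (_ + _).
  rewrite -[LHS]/(c * (expR (- (theta * y)) * y ^+ n.+1)) /c exprMn; ring.
move=> h; apply: (is_derive_eq h).
rewrite /gamma_pdf /GRing.scale /= /c factS natrM.
by rewrite !exprS; field; rewrite nf1 nat1r n1.
Qed.

(** The (k+1)-st term of the exponential series bounds each Poisson term by a
    multiple of 1/x. *)
Lemma cvg_gamma_tail n theta : 0 < theta ->
  gamma_tail n theta x @[x --> +oo] --> 0.
Proof.
move=> theta0.
have inv0 : x^-1 @[x --> +oo] --> (0 : R).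
  apply/(@gtr0_cvgV0 _ _ _ _ id); last exact: cvg_id.
  by near=> x; near: x; exact: nbhs_pinfty_gt.
apply: (@squeeze_cvgr _ _ _ _ (cst 0) (fun x =>
  (\sum_(k < n.+1) (theta^-1 * k.+1%:R)) * x^-1)); last 2 first.
- exact: cvg_cst.
- by rewrite -[X in _ --> X](mulr0 (\sum_(k < n.+1) (theta^-1 * k.+1%:R))); apply: cvgMr.
near=> x.
have x0 : 0 < x by [].
rewrite /cst ltW ?gamma_tail_gt0 ?(ltW theta0) ?(ltW x0)//=.
rewrite /gamma_tail mulr_sumr mulr_suml; apply: ler_sum => k _.
have y0 : 0 < theta * x by rewrite mulr_gt0.
have h := expR_ge1Dxn k (ltW y0); rewrite expRN mulrC ler_pdivrMr ?expR_gt0//.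
have -> : (theta * x) ^+ k / (k`!)%:R =
    theta^-1 * k.+1%:R * x^-1 * ((theta * x) ^+ k.+1 / (k.+1`!)%:R).
  rewrite factS natrM exprS; field.
  by rewrite !gt_eqF //= nat1r ltr0n.
rewrite ler_pM2l; last by rewrite !mulr_gt0 ?invr_gt0 ?ltr0n.
by apply: le_trans h; rewrite lerDr ler01.
Unshelve. all: by end_near. Qed.

(** Repeated integration by parts, except that k = 0 leaves a monomial. *)
Lemma expint_subproof k n : exists A : R -> R,
  A 0 = 0 /\ forall x, is_derive x (1 : R) A (x ^+ n * expR (k * x)).
Proof.
have [->|k0] := eqVneq k 0.
  exists (fun x => n.+1%:R^-1 *: x ^+ n.+1); split.
    by rewrite exprS mul0r scaler0.
  move=> x; have h := is_deriveZ (n.+1%:R^-1 : R) (is_derive_exprn n.+1 x).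
  apply: (is_derive_eq h); rewrite mul0r expR0 mulr1 /GRing.scale /=.
  by rewrite mulKf// pnatr_eq0.
elim: n => [|n [A [A0 dA]]].
  exists (fun x => k^-1 *: (expR (k * x) - 1)); split.
    by rewrite mulr0 expR0 subrr scaler0.
  move=> x.
  have h := is_deriveZ k^-1 (is_deriveB (is_derive_expRM k x) (is_derive_cst (1 : R) x 1)).
  by apply: (is_derive_eq h); rewrite subr0 expr0 mul1r /GRing.scale /= mulKf.
exists (fun x => k^-1 *: (x ^+ n.+1 * expR (k * x) - n.+1%:R *: A x)); split.
  by rewrite A0 exprS !mul0r scaler0 subr0 scaler0.
move=> x.
have h := is_deriveZ k^-1 (is_deriveB
  (is_deriveM (is_derive_exprn n.+1 x) (is_derive_expRM k x))
  (is_deriveZ n.+1%:R (dA x))).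
by apply: (is_derive_eq h); rewrite /GRing.scale /=; field.
Qed.

(** The growth rate k may be negative, zero or positive, and no single closed
    formula covers the three cases; only the derivative and the value at 0
    are ever used. *)
Definition expint k n : R -> R := sval (cid (expint_subproof k n)).

Lemma expint0 k n : expint k n 0 = 0.
Proof. by rewrite /expint; case: cid => A []. Qed.

Lemma is_derive_expint k n x :
  is_derive x 1 (expint k n) (x ^+ n * expR (k * x)).
Proof. by rewrite /expint; case: cid => A []. Qed.

End GammaTail.

(** * Integrals over half-lines *)

(** Additivity survives when the subtracted function has an infinite integral,
    both sides then being -oo.  This is what makes the expected utility -oo
    when the disutility is too heavy. *)
Lemma integral_sub_ge0 (R : realType) d (T : measurableType d) (mu : {measure set T -> \bar R})
    (D : set T) (f g : T -> R) : measurable D ->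
  mu.-integrable D (EFin \o f) -> measurable_fun D (EFin \o g) ->
  (forall x, D x -> 0 <= g x) ->
  (\int[mu]_(x in D) (f x - g x)%:E
   = \int[mu]_(x in D) (f x)%:E - \int[mu]_(x in D) (g x)%:E)%E.
Proof.
move=> mD fi mg g0.
have [gfin|] := boolP (mu.-integrable D (EFin \o g)).
  under eq_integral do rewrite EFinB.
  exact: integralB_EFin.
have mEg : measurable_fun D (EFin \o g) by [].
move=> /integrableP; rewrite not_andP => -[//|/negP]; rewrite -leNgt leye_eq.
have -> : (\int[mu]_(x in D) `|(EFin \o g) x|)%E = (\int[mu]_(x in D) (g x)%:E)%E.
  by apply: eq_integral => x /set_mem Dx /=; rewrite ger0_norm// g0.
move=> /eqP gy; rewrite gy.
have mf := measurable_int _ fi.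
set h := fun x => (f x - g x)%:E.
have mh : measurable_fun D h.
  by apply/measurable_EFinP; apply: measurable_funB; exact/measurable_EFinP.
have fp := integral_funepos_lt_pinfty mD fi.
(* The positive part of f - g is below that of f, so an infinite integral of g
   can only be absorbed by the negative part. *)
have hp : (\int[mu]_(x in D) h^\+ x < +oo)%E.
  apply: le_lt_trans fp; apply: ge0_le_integral => //.
  - exact: measurable_funepos.
  - exact: measurable_funepos.
  - move=> x Dx; apply: (@funepos_le _ _ D) => //; last exact/mem_set.
    by move=> y /set_mem Dy; rewrite /h lee_fin gerBl g0.
have hn : (\int[mu]_(x in D) h^\- x = +oo)%E.
  have : (+oo <= \int[mu]_(x in D) ((EFin \o f)^\+ x + h^\- x))%E.
    rewrite -gy; apply: ge0_le_integral => //.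
    - by apply: emeasurable_funD; [exact: measurable_funepos|exact: measurable_funeneg].
    - move=> x Dx; rewrite funeposE funenegE /h /= -!EFin_max -EFinD lee_fin !maxEle.
      by do 2 case: ifPn => ?; lra.
  rewrite ge0_integralD//; [|exact: measurable_funepos|exact: measurable_funeneg].
  rewrite leye_eq => /eqP; move: fp.
  have := integral_ge0 mu (fun x (_ : D x) => funepos_ge0 (EFin \o f) x).
  by case: (integral _ _ _) => // r; case: (integral _ _ _).
rewrite [LHS]integralE hn.
have := integrable_fin_num mD fi.
move: hp; have := integral_ge0 mu (fun x (_ : D x) => funepos_ge0 h x).
by case: (integral _ _ h^\+%E) => // r _ _; case: (integral _ _ _).
Qed.

Section Integrals.
Context {R : realType}.
Notation leb := (@lebesgue_measure R).
Implicit Types (f F g : R -> R) (a b l x : R).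

Lemma continuous_EFin_measurable f (D : set R) : continuous f ->
  measurable_fun D (EFin \o f).
Proof.
move=> cf; apply: measurable_funTS; apply/measurable_EFinP.
exact: continuous_measurable_fun.
Qed.

Lemma integral_oc f F a b : a <= b -> continuous f ->
  (forall x, is_derive x 1 F (f x)) ->
  (\int[leb]_(x in `]a, b]) (f x)%:E = (F b - F a)%:E)%E.
Proof.
move=> ab cf dF; have cF := is_derive_continuous dF.
move: ab; rewrite le_eqVlt => /predU1P[->|ab].
  by rewrite set_itvoc0 integral_set0 subrr.
rewrite integral_itv_obnd_cbnd; last exact: continuous_EFin_measurable.
rewrite (continuous_FTC2 (F := F) ab) //.
- exact: continuous_subspaceT.
- split => [x _| |]; first by case: (dF x).
    exact: cvg_at_right_filter (cF a).
  exact: cvg_at_left_filter (cF b).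
- by move=> x _; rewrite derive1E; apply: derive_val.
Qed.

Lemma ge0_integral_oy f F a l : (forall x, a <= x -> 0 <= f x) ->
  continuous f -> (forall x, is_derive x 1 F (f x)) ->
  F x @[x --> +oo] --> l ->
  (\int[leb]_(x in `]a, +oo[) (f x)%:E = (l - F a)%:E)%E.
Proof.
move=> f0 cf dF Fl; have cF := is_derive_continuous dF.
rewrite integral_itv_obnd_cbnd; last exact: continuous_EFin_measurable.
rewrite (ge0_continuous_FTC2y (F := F) (l := l)) //.
- exact: continuous_subspaceT.
- exact: cvg_at_right_filter (cF a).
- by move=> x _; rewrite derive1E; apply: derive_val.
Qed.

Lemma integral_lower_bound_infty f (e : R) : 0 < e -> (forall x, 0 < x -> 0 <= f x) ->
  (forall x, 1 <= x -> e <= f x) -> continuous f ->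
  (\int[leb]_(x in `]0%R, +oo[) (f x)%:E = +oo)%E.
Proof.
move=> e0 f0 fe cf; apply/eqP; rewrite -leye_eq.
have -> : (+oo = \int[leb]_(x in `[1%R, +oo[) (cst e%:E x))%E.
  by rewrite integral_cst//= lebesgue_measure_itv/= ltry addye// gt0_muley// lte_fin.
apply: le_trans (_ : (_ <= \int[leb]_(x in `[1%R, +oo[) (f x)%:E)%E) _.
  apply: ge0_le_integral => //.
  - by move=> x _; rewrite lee_fin ltW.
  - exact: continuous_EFin_measurable.
  - by move=> x /=; rewrite in_itv /= andbT => x1; rewrite lee_fin fe.
apply: ge0_subset_integral => //.
- exact: continuous_EFin_measurable.
- by move=> x /=; rewrite in_itv /= andbT => x0; rewrite lee_fin f0.
- by move=> x /=; rewrite !in_itv /= !andbT; exact: lt_le_trans.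
Qed.

End Integrals.

(** * Expectations of Gamma variables *)

Section GammaExpectations.
Context {R : realType}.
Notation leb := (@lebesgue_measure R).
Implicit Types (n : nat) (theta k x d : R).

Lemma continuous_powexp k n : continuous (fun x => x ^+ n * expR (k * x)).
Proof.
move=> x; apply: cvgM.
  exact: (is_derive_continuous (is_derive_exprn n)).
exact: (is_derive_continuous (is_derive_expRM k)).
Qed.

Lemma gamma_pdfE n theta x : gamma_pdf n theta x =
  theta ^+ n.+1 / (n`!)%:R * (x ^+ n * expR (- theta * x)).
Proof. by rewrite /gamma_pdf mulNr; ring. Qed.

Lemma continuous_gamma_pdf n theta : continuous (gamma_pdf n theta).
Proof.
rewrite (_ : gamma_pdf n theta = fun x =>
  theta ^+ n.+1 / (n`!)%:R * (x ^+ n * expR (- theta * x))); last first.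
  by apply/funext => x; rewrite gamma_pdfE.
by move=> x; apply: cvgM; [exact: cvg_cst|exact: continuous_powexp].
Qed.

Lemma gamma_pdf_ge0 n theta x : 0 <= theta -> 0 <= x -> 0 <= gamma_pdf n theta x.
Proof.
move=> theta0 x0; rewrite /gamma_pdf divr_ge0//.
by rewrite !mulr_ge0 ?expR_ge0// exprn_ge0.
Qed.

Lemma gamma_pdf_mulr n theta x : 0 < theta ->
  x * gamma_pdf n theta x = n.+1%:R / theta * gamma_pdf n.+1 theta x.
Proof.
move=> theta0; rewrite /gamma_pdf factS natrM !exprS; field.
by rewrite nat1r !gt_eqF ?ltr0n ?fact_gt0.
Qed.

Lemma integral_gamma_tail n theta d : 0 < theta -> 0 <= d ->
  (\int[leb]_(x in `]d, +oo[) (gamma_pdf n theta x)%:E = (gamma_tail n theta d)%:E)%E.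
Proof.
move=> theta0 d0.
have dF x : is_derive x 1 (fun x => - gamma_tail n theta x) (gamma_pdf n theta x).
  have h := is_deriveN (is_derive_gamma_tail n theta x).
  by apply: (is_derive_eq h); rewrite opprK.
have Fy : - gamma_tail n theta x @[x --> +oo] --> 0.
  by rewrite -[X in _ --> X]oppr0; apply: cvgN; exact: cvg_gamma_tail.
rewrite (ge0_integral_oy _ _ dF Fy) ?sub0r ?opprK//; last exact: continuous_gamma_pdf.
by move=> x dx; rewrite gamma_pdf_ge0 ?(ltW theta0) ?(le_trans d0).
Qed.

(** The maximum with 0 covers the level d = -1, which occurs as a conventional
    threshold. *)
Lemma Egamma_indicator n theta d : 0 < theta ->
  Egamma n theta (\1_(`]d, +oo[%classic : set R))
  = (gamma_tail n theta (Num.max d 0))%:E.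
Proof.
move=> theta0; rewrite /Egamma.
rewrite -integral_gamma_tail ?le_max ?lexx ?orbT//.
transitivity (\int[leb]_(x in `]0%R, +oo[)
    ((fun x => (gamma_pdf n theta x)%:E) \_ `]d, +oo[) x)%E.
  apply: eq_integral => x _.
  by rewrite /patch indicE; case: ifP => _; rewrite ?mul1r ?mul0r.
rewrite -integral_mkcondr; congr integral.
apply/seteqP; split => x /=; rewrite !in_itv/= !andbT gt_max.
  by move=> [-> ->].
by move=> /andP[-> ->].
Qed.

(** E(X - d)^+ for X of law Gamma(n+1, theta): size-biasing a Gamma(n+1) law
    gives (n+1)/theta times a Gamma(n+2) law ([gamma_pdf_mulr]). *)
Definition mean_excess n theta d : R :=
  n.+1%:R / theta * gamma_tail n.+1 theta d - d * gamma_tail n theta d.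

Lemma is_derive_mean_excess n theta d : 0 < theta ->
  is_derive d 1 (mean_excess n theta) (- gamma_tail n theta d).
Proof.
move=> theta0.
have h := is_deriveB
  (is_deriveZ (n.+1%:R / theta) (is_derive_gamma_tail n.+1 theta d))
  (is_deriveM (is_derive_id d (1 : R)) (is_derive_gamma_tail n theta d)).
apply: (is_derive_eq h); rewrite /GRing.scale /= mulrN mulrN gamma_pdf_mulr//.
by rewrite mulr1; ring.
Qed.

(** Up to the factor (n+1)/theta, multiplying by x shifts the Poisson terms by
    one, hence stays below the next Gamma tail. *)
Lemma cvg_id_gamma_tail n theta : 0 < theta ->
  x * gamma_tail n theta x @[x --> +oo] --> 0.
Proof.
move=> theta0.
apply: (@squeeze_cvgr _ _ _ _ (cst 0) (fun x =>
  n.+1%:R / theta * gamma_tail n.+1 theta x)); last 2 first.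
- exact: cvg_cst.
- by rewrite -[X in _ --> X](mulr0 (n.+1%:R / theta)); apply: cvgMr; exact: cvg_gamma_tail.
near=> x.
have x0 : 0 < x by [].
rewrite mulr_ge0 ?(ltW x0) ?(ltW (gamma_tail_gt0 _ _ _)) ?(ltW theta0) ?(ltW x0)//=.
rewrite /gamma_tail mulrCA [leRHS]mulrCA ler_pM2l ?expR_gt0//.
rewrite [in leRHS]big_ord_recl /= mulrDr !mulr_sumr -[leLHS]add0r lerD//.
  by rewrite mulr_ge0 ?divr_ge0 ?expr0 ?fact0 ?ltW.
apply: ler_sum => i _; rewrite /bump /= add1n factS natrM exprS.
have -> : n.+1%:R / theta * (theta * x * (theta * x) ^+ i / (i.+1%:R * i`!%:R)) =
  n.+1%:R / i.+1%:R * (x * ((theta * x) ^+ i / i`!%:R)).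
  by field; rewrite nat1r !gt_eqF ?ltr0n ?fact_gt0.
rewrite ler_peMl//; last by rewrite ler_pdivlMr ?ltr0n// mul1r ler_nat.
by rewrite mulr_ge0 ?(ltW x0)// divr_ge0// exprn_ge0// mulr_ge0 ?ltW.
Unshelve. all: by end_near. Qed.

Lemma cvg_mean_excess n theta : 0 < theta ->
  mean_excess n theta x @[x --> +oo] --> 0.
Proof.
move=> theta0; rewrite -[X in _ --> X](subr0 0); apply: cvgB.
  rewrite -[X in _ --> X](mulr0 (n.+1%:R / theta)).
  by apply: cvgMr; exact: cvg_gamma_tail.
exact: cvg_id_gamma_tail.
Qed.

Lemma delayE x d : delay x d%:E = Num.max (x - d) 0.
Proof. by rewrite /delay -EFinB -EFin_max. Qed.

Lemma delay_infty x : delay x +oo%E = 0.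
Proof. by rewrite /delay /= addeNy maxNye. Qed.

Lemma Egamma_delay n theta d : 0 < theta -> 0 <= d ->
  Egamma n theta (fun x => delay x d%:E) = (mean_excess n theta d)%:E.
Proof.
move=> theta0 d0; rewrite /Egamma.
transitivity (\int[leb]_(x in `]0%R, +oo[)
    ((fun x => ((x - d) * gamma_pdf n theta x)%:E) \_ `]d, +oo[) x)%E.
  apply: eq_integral => x _; rewrite /patch delayE mem_setE in_itv/= andbT.
  by case: ltP => dx; [rewrite max_l ?subr_ge0 ?ltW|rewrite max_r ?mul0r ?subr_le0].
rewrite -integral_mkcondr.
have -> : (`]0, +oo[%classic `&` `]d, +oo[%classic = `]d, +oo[%classic :> set R).
  apply/seteqP; split => x /=; rewrite !in_itv/= !andbT; first by case.
  by move=> dx; split=> //; exact: le_lt_trans dx.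
pose F x := d * gamma_tail n theta x - n.+1%:R / theta * gamma_tail n.+1 theta x.
have dF x : is_derive x 1 F ((x - d) * gamma_pdf n theta x).
  have h := is_deriveB (is_deriveZ d (is_derive_gamma_tail n theta x))
    (is_deriveZ (n.+1%:R / theta) (is_derive_gamma_tail n.+1 theta x)).
  apply: (is_derive_eq h); rewrite /GRing.scale /= mulrN mulrN opprK.
  by rewrite mulrBl gamma_pdf_mulr//; ring.
have Fy : F x @[x --> +oo] --> 0.
  rewrite -[X in _ --> X](subr0 0); apply: cvgB.
    by rewrite -[X in _ --> X](mulr0 d); apply: cvgMr; exact: cvg_gamma_tail.
  rewrite -[X in _ --> X](mulr0 (n.+1%:R / theta)).
  by apply: cvgMr; exact: cvg_gamma_tail.
rewrite (ge0_integral_oy _ _ dF Fy) /F /mean_excess.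
- by congr _%:E; ring.
- by move=> x dx; rewrite mulr_ge0 ?subr_ge0// gamma_pdf_ge0 ?(ltW theta0) ?(le_trans d0).
- move=> x; apply: cvgM; last exact: continuous_gamma_pdf.
  by apply: cvgB; [exact: cvg_id|exact: cvg_cst].
Qed.

End GammaExpectations.

(** * Sojourn times in queues with different service rates *)

Section TailRatio.
Context {R : realType}.
Implicit Types (n : nat) (th x y d : R).

Lemma is_derive_quotient (f g : R -> R) (x a b : R) : g x != 0 ->
  is_derive x (1 : R) f a -> is_derive x (1 : R) g b ->
  is_derive x (1 : R) (fun y => f y / g y) ((a * g x - f x * b) / g x ^+ 2).
Proof.
move=> gx0 df dg.
have dV : is_derive x (1 : R) (fun y => (g y)^-1) (- (g x) ^- 2 *: b).
  apply: DeriveDef; first by apply: derivableV => //; case: dg.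
  by case: dg => dg1 dg2; rewrite deriveV// dg2.
have h := is_deriveM df dV.
by apply: (is_derive_eq h); rewrite /GRing.scale /=; field.
Qed.

Context (N : nat) (N_gt0 : (0 < N)%N) (la : R) (la_gt0 : 0 < la).

Definition unnormalized_tail th d : R :=
  \sum_(n < N) (la / th) ^+ n * gamma_tail n th d.

Lemma sojourn_tailE th d : 0 < th ->
  sojourn_tail la th N d =
  unnormalized_tail th (Num.max d 0) / \sum_(k < N.+1) (la / th) ^+ k.
Proof.
move=> th0; rewrite /sojourn_tail /unnormalized_tail mulr_suml.
by apply: eq_bigr => n _; rewrite Egamma_indicator//= /qst; ring.
Qed.

Lemma unnormalized_tail_gt0 th d : 0 < th -> 0 <= d -> 0 < unnormalized_tail th d.
Proof.
move=> th0 d0; rewrite /unnormalized_tail -(big_mkord xpredT (fun n => (la / th) ^+ n * gamma_tail n th d)).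
rewrite big_ltn//= ltr_pwDl//; first by rewrite expr0 mul1r gamma_tail_gt0 ?(ltW th0).
apply: sumr_ge0 => n _; apply: mulr_ge0; last by rewrite gamma_tail_ge0 ?(ltW th0).
by rewrite exprn_ge0 ?divr_ge0 ?ltW.
Qed.

(** The same polynomial in the sojourn densities of all service rates: this is
    what makes the hazard rates comparable. *)
Let truncexp x : R := \sum_(n < N) (la * x) ^+ n / (n`!)%:R.

Let truncexp_gt0 x : 0 <= x -> 0 < truncexp x.
Proof.
move=> x0; rewrite /truncexp -(big_mkord xpredT (fun n => (la * x) ^+ n / (n`!)%:R)).
rewrite big_ltn//= expr0 fact0 divr1 ltr_pwDl// sumr_ge0// => n _.
by rewrite divr_ge0 ?exprn_ge0 ?mulr_ge0 ?(ltW la_gt0).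
Qed.

Lemma is_derive_unnormalized_tail th d : 0 < th ->
  is_derive d 1 (unnormalized_tail th) (- (th * expR (- (th * d)) * truncexp d)).
Proof.
move=> th0.
have -> : unnormalized_tail th = \sum_(n < N) (la / th) ^+ n \*: gamma_tail n th.
  by apply/funext => x; rewrite /unnormalized_tail fct_sumE.
have h := is_derive_sum (fun n : 'I_N =>
  is_deriveZ ((la / th) ^+ n) (is_derive_gamma_tail n th d)).
apply: (is_derive_eq h); rewrite /truncexp mulr_sumr -sumrN.
apply: eq_bigr => n _; rewrite /GRing.scale /= /gamma_pdf expr_div_n exprS exprMn.
have tn0 : th ^+ n != 0 by rewrite expf_neq0// gt_eqF.
by field; rewrite tn0 pnatr_eq0 -lt0n fact_gt0.
Qed.

(** [truncexp] times the Mills ratio, tail over density, of the sojourn time.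
    Written as a sum of monomials in x and 1/th with nonnegative coefficients,
    it is visibly decreasing in th. *)
Let scaled_mills th x : R :=
  \sum_(n < N) \sum_(k < n.+1) (la ^+ n * x ^+ k / (k`!)%:R) * th ^- (n.+1 - k).

Let unnormalized_tailE th x : 0 < th ->
  unnormalized_tail th x = th * expR (- (th * x)) * scaled_mills th x.
Proof.
move=> th0; rewrite /unnormalized_tail /scaled_mills mulr_sumr; apply: eq_bigr => n _.
rewrite /gamma_tail mulrCA !mulr_sumr; apply: eq_bigr => k _.
have kn : (k <= n)%N by rewrite -ltnS.
rewrite subSn// exprS expr_div_n exprMn.
have -> : th ^+ n = th ^+ (n - k) * th ^+ k by rewrite -exprD subnK.
have tn0 m : th ^+ m != 0 by rewrite expf_neq0// gt_eqF.
by field; rewrite !tn0 gt_eqF//= pnatr_eq0 -lt0n fact_gt0.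
Qed.

Let scaled_mills_le th1 th2 x : 0 < th2 -> th2 <= th1 -> 0 <= x ->
  scaled_mills th1 x <= scaled_mills th2 x.
Proof.
move=> t20 t21 x0; have t10 := lt_le_trans t20 t21.
apply: ler_sum => n _; apply: ler_sum => k _; apply: ler_wpM2l.
  by rewrite divr_ge0// mulr_ge0 ?exprn_ge0 ?(ltW la_gt0).
by rewrite lef_pV2 ?posrE ?exprn_gt0// lerXn2r ?nnegrE ?(ltW t20) ?(ltW t10).
Qed.

(** At x = 0 some terms vanish, but only interior points of an interval are
    needed to compare the values at its ends. *)
Let scaled_mills_lt th1 th2 x : 0 < th2 -> th2 < th1 -> 0 < x ->
  scaled_mills th1 x < scaled_mills th2 x.
Proof.
move=> t20 t21 x0; have t10 := lt_trans t20 t21.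
apply: ltr_sum => [|n _].
  by apply/hasP; exists (Ordinal N_gt0) => //; rewrite mem_index_enum.
apply: ltr_sum => [|k _].
  by apply/hasP; exists ord0 => //; rewrite mem_index_enum.
rewrite ltr_pM2l ?divr_gt0 ?mulr_gt0 ?exprn_gt0 ?ltr0n ?fact_gt0//.
rewrite ltf_pV2 ?posrE ?exprn_gt0// ltrXn2r ?nnegrE ?ltW//.
by rewrite -lt0n subn_gt0.
Qed.

Definition tail_ratio th1 th2 x : R := unnormalized_tail th1 x / unnormalized_tail th2 x.

(** Up to a positive factor, the numerator of the quotient rule is the
    difference of the Mills ratios. *)
Lemma is_derive_tail_ratio th1 th2 x : 0 < th1 -> 0 < th2 -> 0 <= x ->
  is_derive x 1 (tail_ratio th1 th2)
   (th1 * th2 * expR (- (th1 * x)) * expR (- (th2 * x)) * truncexp x / unnormalized_tail th2 x ^+ 2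
     * (scaled_mills th1 x - scaled_mills th2 x)).
Proof.
move=> t1 t2 x0; have u0 : unnormalized_tail th2 x != 0 by rewrite gt_eqF// unnormalized_tail_gt0.
have h := is_derive_quotient u0 (is_derive_unnormalized_tail x t1) (is_derive_unnormalized_tail x t2).
apply: (is_derive_eq h); rewrite [X in X / _ = _](_ : _ =
  th1 * th2 * expR (- (th1 * x)) * expR (- (th2 * x)) * truncexp x * (scaled_mills th1 x - scaled_mills th2 x)); last first.
  by rewrite !unnormalized_tailE//; ring.
by rewrite mulrAC.
Qed.

Lemma tail_ratio_gt0 th1 th2 x : 0 < th1 -> 0 < th2 -> 0 <= x -> 0 < tail_ratio th1 th2 x.
Proof. by move=> t1 t2 x0; rewrite divr_gt0 ?unnormalized_tail_gt0. Qed.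

Let slope_coef_gt0 th1 th2 x : 0 < th1 -> 0 < th2 -> 0 <= x ->
  0 < th1 * th2 * expR (- (th1 * x)) * expR (- (th2 * x)) * truncexp x / unnormalized_tail th2 x ^+ 2.
Proof.
move=> t1 t2 x0; rewrite divr_gt0 ?exprn_gt0 ?unnormalized_tail_gt0//.
by apply: mulr_gt0; [rewrite !mulr_gt0 ?expR_gt0|exact: truncexp_gt0].
Qed.

Lemma tail_ratio_nincr th1 th2 x y : 0 < th2 -> th2 <= th1 -> 0 <= x -> x <= y ->
  tail_ratio th1 th2 y <= tail_ratio th1 th2 x.
Proof.
move=> t20 t21 x0 xy; have t10 := lt_le_trans t20 t21.
apply: is_derive_ger xy _ => z /andP[xz _].
- by apply: is_derive_tail_ratio => //; exact: le_trans xz.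
- have z0 : 0 <= z by exact: le_trans (ltW xz).
  by rewrite mulr_ge0_le0 ?(ltW (slope_coef_gt0 _ _ _))// subr_le0 scaled_mills_le.
Qed.

Lemma tail_ratio_decr th1 th2 x y : 0 < th2 -> th2 < th1 -> 0 <= x -> x < y ->
  tail_ratio th1 th2 y < tail_ratio th1 th2 x.
Proof.
move=> t20 t21 x0 xy; have t10 := lt_trans t20 t21.
apply: is_derive_gtr xy _ => z /andP[xz _].
- by apply: is_derive_tail_ratio => //; exact: le_trans xz.
- have z0 : 0 < z by exact: le_lt_trans xz.
  by rewrite pmulr_rlt0 ?slope_coef_gt0 ?(ltW z0)// subr_lt0 scaled_mills_lt.
Qed.

Lemma tail_ratio_le th1 th2 x : 0 < th2 -> th2 <= th1 -> 0 <= x ->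
  tail_ratio th1 th2 x <= th1 / th2 * expR (- ((th1 - th2) * x)).
Proof.
move=> t20 t21 x0; have t10 := lt_le_trans t20 t21.
rewrite /tail_ratio ler_pdivrMr ?unnormalized_tail_gt0// !unnormalized_tailE//.
have -> : th1 / th2 * expR (- ((th1 - th2) * x)) * (th2 * expR (- (th2 * x)) * scaled_mills th2 x) =
  th1 * expR (- (th1 * x)) * scaled_mills th2 x.
  have -> : expR (- (th1 * x)) = expR (- ((th1 - th2) * x)) * expR (- (th2 * x)).
    by rewrite -expRD; congr expR; ring.
  by field; rewrite gt_eqF.
by rewrite ler_pM2l ?scaled_mills_le// mulr_gt0 ?expR_gt0.
Qed.

(** The condition on k is the one under which the exponential bound of
    [tail_ratio_le] is beaten. *)
Lemma cvg_tail_ratio_expR th1 th2 k : 0 < th2 -> th2 <= th1 -> th2 - th1 < k ->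
  tail_ratio th1 th2 x * expR (- (k * x)) @[x --> +oo] --> 0.
Proof.
move=> t20 t21 kt; have t10 := lt_le_trans t20 t21.
have m0 : 0 < th1 - th2 + k by lra.
apply: (@squeeze_cvgr _ _ _ _ (cst 0) (fun x =>
  th1 / th2 * gamma_tail 0 (th1 - th2 + k) x)); last 2 first.
- exact: cvg_cst.
- by rewrite -[X in _ --> X](mulr0 (th1 / th2)); apply: cvgMr; exact: cvg_gamma_tail.
near=> x.
have x0 : 0 <= x by [].
rewrite /cst /= mulr_ge0 ?expR_ge0 ?(ltW (tail_ratio_gt0 _ _ _))//=.
apply: le_trans (_ : _ <= th1 / th2 * expR (- ((th1 - th2) * x)) * expR (- (k * x))) _.
  by rewrite ler_pM2r ?expR_gt0// tail_ratio_le.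
rewrite -mulrA -expRD /gamma_tail big_ord1 expr0 fact0 divr1 mulr1.
by rewrite (_ : - _ + - _ = - ((th1 - th2 + k) * x))//; ring.
Unshelve. all: by end_near. Qed.

End TailRatio.

(** * Least elements *)

Lemma first_nat_SomeP (P : pred nat) n :
  first_nat P = Some n <-> P n /\ (forall m, (m < n)%N -> ~~ P m).
Proof.
rewrite /first_nat; split.
  case: pselect => // exP [<-]; case: ex_minnP => k Pk kmin; split=> // m mk.
  by apply/negP => /kmin; rewrite leqNgt mk.
move=> [Pn nmin]; case: pselect => [exP|[]]; last by exists n.
congr Some; case: ex_minnP => k Pk kmin; apply/eqP; rewrite eqn_leq kmin//=.
by rewrite leqNgt; apply/negP => /nmin; rewrite Pk.
Qed.

Lemma first_nat_NoneP (P : pred nat) : first_nat P = None <-> forall m, ~~ P m.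
Proof.
rewrite /first_nat; split.
  by case: pselect => // nP _ m; apply/negP => Pm; apply: nP; exists m.
by move=> nP; case: pselect => // -[m Pm]; move: (nP m); rewrite Pm.
Qed.

Lemma onat_ereal_ge_first (R : realType) (P : pred nat) n :
  (n%:R%:E <= onat_ereal R (first_nat P))%E <-> forall m, (m < n)%N -> ~~ P m.
Proof.
case E : (first_nat P) => [k|] /=; last first.
  by split=> [_ m _|_]; [move: E => /first_nat_NoneP; apply|exact: leey].
move: E => /first_nat_SomeP[Pk kmin]; rewrite lee_fin ler_nat; split.
  by move=> nk m mn; apply: kmin; exact: leq_trans nk.
by move=> h; rewrite leqNgt; apply/negP => /h; rewrite Pk.
Qed.

Lemma onat_ereal_le_first (R : realType) (P : pred nat) n :
  (onat_ereal R (first_nat P) <= n%:R%:E)%E <-> exists2 m, (m <= n)%N & P m.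
Proof.
case E : (first_nat P) => [k|] /=; last first.
  split=> // -[m _ Pm]; move: E => /first_nat_NoneP/(_ m); rewrite Pm.
  by [].
move: E => /first_nat_SomeP[Pk kmin]; rewrite lee_fin ler_nat; split.
  by move=> kn; exists k.
move=> [m mn Pm]; apply: leq_trans mn; rewrite leqNgt; apply/negP => /kmin.
by rewrite Pm.
Qed.

(** * Closed forms of the expected utility *)

Section Definitions.
Context {R : realType} (M : model R).
Implicit Types (n : nat) (x : R).

(** Only the exponential part of the utility: it is nonnegative, so that its
    integral makes sense even when it is infinite. *)
Definition utility_loss n (d : \bar R) x : R :=
  expR (- (risk M * (reward M - fee M - cwait M * x + lcomp M * delay x d)))
  / risk M * gamma_pdf n (mu M) x.

(** E exp(r (c X - l (X - x)^+)) for X of law Gamma(n+1, mu): the first term is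
    the contribution of X <= x, where the exponent grows at rate r c, and the
    second that of X > x, where the tilted law is Gamma(n+1, v). *)
Definition waiting_factor n x : R :=
  mu M ^+ n.+1 / (n`!)%:R * expint (risk M * cwait M - mu M) n x
  + expR (risk M * lcomp M * x) * (mu M / vrate M) ^+ n.+1
    * gamma_tail n (vrate M) x.

(** The value of B_n at a finite quote. *)
Definition utility n x : R :=
  (1 - expR (- (risk M * (reward M - fee M))) * waiting_factor n x) / risk M.

(** The value of B_n without compensation, when r c < mu. *)
Definition utility_infty n : R :=
  (1 - expR (- (risk M * (reward M - fee M)))
       * (mu M / (mu M - risk M * cwait M)) ^+ n.+1) / risk M.

(** S_c at a finite quote with balking threshold N, as a function defined and
    smooth regardless of the actual threshold of the quote. *)
Definition welfare (N : nat) x : R := lam M * \sum_(n < N) qst (rho M) n N *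
  (fee M - lcomp M * mean_excess n (mu M) x + utility n x).

End Definitions.

Section Quotes.
Context {R : realType} (M : model R).
Notation leb := (@lebesgue_measure R).
Notation K := (expR (- (risk M * (reward M - fee M)))).
Notation la := (lam M).
Notation mu := (mu M).
Notation l := (lcomp M).
Notation r := (risk M).
Notation v := (vrate M).
Implicit Types (n m : nat) (x y : R) (d : \bar R).
Context (mu_gt0 : 0 < mu) (risk_gt0 : 0 < r).

Lemma continuous_utility_loss n d : (0 <= d)%E -> continuous (utility_loss M n d).
Proof.
move=> d0 x; apply: cvgM; last exact: continuous_gamma_pdf.
apply: cvgM; last exact: cvg_cst.
apply: continuous_cvg; first exact: continuous_expR.
apply: cvgN; apply: cvgM; first exact: cvg_cst.
apply: cvgD.
  apply: cvgB; first exact: cvg_cst.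
  by apply: cvgM; [exact: cvg_cst|exact: cvg_id].
apply: cvgM; first exact: cvg_cst.
move: d0; case: d => [d| |] // d0.
- rewrite (_ : (fun y : R => delay y d%:E) = fun x => Num.max (x - d) 0); last first.
    by apply/funext => y; rewrite delayE.
  rewrite delayE; apply: (@continuous_max R R (fun x => x - d) (cst 0)).
    by apply: cvgB; [exact: cvg_id|exact: cvg_cst].
  exact: cvg_cst.
- rewrite (_ : (fun y : R => delay y +oo%E) = cst 0); first by rewrite delay_infty; exact: cvg_cst.
  by apply/funext => y; rewrite delay_infty.
Qed.

Lemma utility_loss_ge0 n d x : 0 <= x -> 0 <= utility_loss M n d x.
Proof.
move=> x0; apply: mulr_ge0; last by rewrite gamma_pdf_ge0 ?(ltW mu_gt0).
by rewrite divr_ge0 ?expR_ge0 ?(ltW risk_gt0).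
Qed.

Lemma integral_gamma_pdf n theta : 0 < theta ->
  (\int[leb]_(x in `]0%R, +oo[) (gamma_pdf n theta x)%:E = 1)%E.
Proof. by move=> theta0; rewrite integral_gamma_tail// gamma_tailE0. Qed.

Lemma B_utility_loss n d : (0 <= d)%E ->
  (B M n d = r^-1%:E - \int[leb]_(x in `]0%R, +oo[) (utility_loss M n d x)%:E)%E.
Proof.
move=> d0; rewrite /B /Egamma.
pose f x := r^-1 * gamma_pdf n mu x.
transitivity (\int[leb]_(x in `]0%R, +oo[) (f x - utility_loss M n d x)%:E)%E.
  by apply: eq_integral => x _; rewrite /f /utility_loss; congr _%:E; ring.
have cf : continuous f.
  by move=> x; apply: cvgM; [exact: cvg_cst|exact: continuous_gamma_pdf].
have fE : (\int[leb]_(x in `]0%R, +oo[) (f x)%:E = r^-1%:E)%E.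
  under eq_integral do rewrite EFinM.
  rewrite ge0_integralZl_EFin//.
  - by rewrite integral_gamma_pdf ?mule1.
  - by move=> x /=; rewrite in_itv/= andbT lee_fin => /ltW x0; rewrite gamma_pdf_ge0 ?(ltW mu_gt0).
  - by apply: continuous_EFin_measurable; exact: continuous_gamma_pdf.
  - by rewrite invr_ge0 ltW.
have f0 x : 0 < x -> 0 <= f x.
  by move=> x0; rewrite mulr_ge0 ?invr_ge0 ?gamma_pdf_ge0 ?ltW.
rewrite integral_sub_ge0 ?fE//.
- apply/integrableP; split; first exact: continuous_EFin_measurable.
  rewrite [X in (X < _)%E](_ : _ = r^-1%:E) ?ltry// -fE; apply: eq_integral => x.
  by rewrite inE/= in_itv/= andbT => x0; rewrite ger0_norm// f0.
- by apply: continuous_EFin_measurable; exact: continuous_utility_loss.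
- by move=> x /=; rewrite in_itv/= andbT => /ltW; exact: utility_loss_ge0.
Qed.

Lemma utility_loss_before n d x : (x%:E <= d)%E -> utility_loss M n d x =
  K / r * (mu ^+ n.+1 / (n`!)%:R) *
  (x ^+ n * expR ((r * cwait M - mu) * x)).
Proof.
move=> xd; rewrite /utility_loss.
have -> : delay x d = 0.
  move: xd; case: d => [d| |] //=; last by rewrite delay_infty.
  by rewrite lee_fin delayE => xd; rewrite max_r ?subr_le0.
have -> : expR (- (r * (reward M - fee M - cwait M * x + l * 0))) =
    K * expR (r * cwait M * x).
  by rewrite -expRD; congr expR; ring.
by rewrite gamma_pdfE mulrDl expRD; ring.
Qed.

Lemma utility_loss_after n (d x : R) : 0 < v -> d <= x -> utility_loss M n d%:E x =
  K / r * (expR (r * l * d) * (mu / v) ^+ n.+1) *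
  gamma_pdf n v x.
Proof.
move=> v0 dx; rewrite /utility_loss delayE max_l ?subr_ge0// /gamma_pdf.
rewrite expr_div_n.
have -> : expR (- (r * (reward M - fee M - cwait M * x + l * (x - d)))) =
  K * expR (r * l * d) * expR (- (v * x)) * expR (mu * x).
  by rewrite -!expRD; congr expR; rewrite /vrate; ring.
have vn0 : v ^+ n.+1 != 0 by rewrite expf_neq0// gt_eqF.
have mE : expR (- (mu * x)) * expR (mu * x) = 1 by rewrite -expRD addNr expR0.
have nf0 : (n`!)%:R != 0 :> R by rewrite pnatr_eq0 -lt0n fact_gt0.
rewrite -[RHS]mulr1 -mE; field.
by rewrite nf0 vn0 !gt_eqF ?expR_gt0.
Qed.

Lemma B_utility n (d : R) : 0 < v -> 0 <= d -> B M n d%:E = (utility M n d)%:E.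
Proof.
move=> v0 d0; rewrite B_utility_loss ?lee_fin//.
have ml D : measurable_fun D (EFin \o utility_loss M n d%:E).
  by apply: continuous_EFin_measurable; apply: continuous_utility_loss; rewrite lee_fin.
rewrite (@itv_bndbnd_setU _ _ _ (BRight d)) ?bnd_simp//.
rewrite ge0_integral_setU//=; last 2 first.
- move=> x [|] /=; rewrite in_itv/= => /andP[x0 _]; rewrite lee_fin utility_loss_ge0//.
    exact: ltW.
  by rewrite (le_trans d0)// ltW.
- apply/disj_setPS => x [] /=; rewrite !in_itv/= andbT => /andP[_ xd].
  by rewrite ltNge xd.
have cpe := @continuous_powexp R (r * cwait M - mu) n.
have rec0 : 0 <= K / r by rewrite divr_ge0 ?expR_ge0 ?ltW.
have i1 : (\int[leb]_(x in `]0%R, d]) (utility_loss M n d%:E x)%:E = (K / r *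
    (mu ^+ n.+1 / (n`!)%:R) * expint (r * cwait M - mu) n d)%:E)%E.
  transitivity (\int[leb]_(x in `]0%R, d]) ((K / r *
    (mu ^+ n.+1 / (n`!)%:R))%:E * (x ^+ n * expR ((r * cwait M - mu) * x))%:E))%E.
    apply: eq_integral => x; rewrite inE/= in_itv/= => /andP[_ xd].
    by rewrite -EFinM -(@utility_loss_before n d%:E) ?lee_fin.
  rewrite ge0_integralZl_EFin//.
  - by rewrite (integral_oc d0 cpe (is_derive_expint _ _)) expint0 subr0 -EFinM.
  - move=> x; rewrite /= in_itv/= lee_fin => /andP[/ltW x0 _].
    by rewrite mulr_ge0 ?expR_ge0 ?exprn_ge0.
  - exact: continuous_EFin_measurable.
  - by rewrite mulr_ge0 ?divr_ge0 ?exprn_ge0 ?expR_ge0 ?ltW.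
have i2 : (\int[leb]_(x in `]d, +oo[) (utility_loss M n d%:E x)%:E = (K / r *
    (expR (r * l * d) * (mu / v) ^+ n.+1) * gamma_tail n v d)%:E)%E.
  transitivity (\int[leb]_(x in `]d, +oo[) ((K / r *
    (expR (r * l * d) * (mu / v) ^+ n.+1))%:E * (gamma_pdf n v x)%:E))%E.
    apply: eq_integral => x; rewrite inE/= in_itv/= andbT => /ltW dx.
    by rewrite -EFinM -utility_loss_after.
  rewrite ge0_integralZl_EFin//.
  - by rewrite integral_gamma_tail// -EFinM.
  - move=> x; rewrite /= in_itv/= andbT lee_fin => /ltW dx.
    by rewrite gamma_pdf_ge0 ?(ltW v0) ?(le_trans d0).
  - by apply: continuous_EFin_measurable; exact: continuous_gamma_pdf.
  - by rewrite mulr_ge0// mulr_ge0 ?expR_ge0// exprn_ge0// divr_ge0 ?ltW.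
rewrite i1 i2 -!EFinD; congr _%:E; rewrite /utility /waiting_factor.
by field; rewrite !gt_eqF// ltr0n fact_gt0.
exact: ml.
Qed.

Lemma B_infty n : r * cwait M < mu -> B M n +oo%E =
  ((1 - K * (mu / (mu - r * cwait M)) ^+ n.+1) / r)%:E.
Proof.
move=> rc; have k0 : 0 < mu - r * cwait M by rewrite subr_gt0.
rewrite B_utility_loss//.
pose C := K / r * (mu / (mu - r * cwait M)) ^+ n.+1.
have -> : (\int[leb]_(x in `]0%R, +oo[) (utility_loss M n +oo%E x)%:E = C%:E)%E.
  transitivity (\int[leb]_(x in `]0%R, +oo[)
      (C%:E * (gamma_pdf n (mu - r * cwait M) x)%:E))%E.
    apply: eq_integral => x _; rewrite -EFinM utility_loss_before ?leey// gamma_pdfE opprB /C.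
    rewrite expr_div_n; congr _%:E; field.
    rewrite !gt_eqF ?ltr0n ?fact_gt0//=.
    by rewrite exprn_gt0.
  rewrite ge0_integralZl_EFin//.
  - by rewrite integral_gamma_pdf// mule1.
  - move=> x; rewrite /= in_itv/= andbT lee_fin => /ltW dx.
    by rewrite gamma_pdf_ge0 ?(ltW k0).
  - by apply: continuous_EFin_measurable; exact: continuous_gamma_pdf.
  - by rewrite /C mulr_ge0 ?divr_ge0 ?exprn_ge0 ?divr_ge0 ?expR_ge0 ?ltW.
by rewrite -EFinB /C; congr _%:E; ring.
Qed.

(** Without compensation the disutility grows like exp(r c x), which the
    density can no longer compensate. *)
Lemma B_infty_ninfty n : mu <= r * cwait M -> B M n +oo%E = -oo%E.
Proof.
move=> rc; rewrite B_utility_loss//.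
rewrite (@integral_lower_bound_infty _ _ (K / r * (mu ^+ n.+1 / (n`!)%:R))) //.
- by rewrite mulr_gt0 ?divr_gt0 ?expR_gt0 ?exprn_gt0 ?ltr0n ?fact_gt0.
- by move=> x /ltW; exact: utility_loss_ge0.
- move=> x x1; rewrite utility_loss_before ?leey// ler_peMr//.
    by rewrite mulr_ge0 ?divr_ge0 ?exprn_ge0 ?expR_ge0 ?ltW.
  have x0 : 0 <= x by rewrite (le_trans _ x1).
  rewrite -[leLHS]mulr1 ler_pM// ?exprn_ege1//.
  by rewrite (le_trans _ (expR_ge1Dx _))// lerDl mulr_ge0// subr_ge0.
- exact: continuous_utility_loss.
Qed.

Lemma B0_ninfty : v <= 0 -> B M 0 0%E = -oo%E.
Proof.
move=> v0; rewrite B_utility_loss//.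
rewrite (@integral_lower_bound_infty _ _ (K / r * mu)) //.
- by rewrite mulr_gt0 ?divr_gt0 ?expR_gt0.
- by move=> x /ltW; exact: utility_loss_ge0.
- move=> x x1; have x0 : 0 <= x by rewrite (le_trans _ x1).
  rewrite /utility_loss delayE subr0 max_l// gamma_pdfE expr1 expr0 fact0 divr1 mul1r.
  have -> : expR (- (r * (reward M - fee M - cwait M * x + l * x))) /
      r * (mu * expR (- mu * x)) =
    K / r * mu * expR (- (v * x)).
    have -> : expR (- (r * (reward M - fee M - cwait M * x + l * x))) =
      K * expR (- (v * x)) * expR (mu * x).
      by rewrite -!expRD; congr expR; rewrite /vrate; ring.
    have mE : expR (mu * x) * expR (- mu * x) = 1 by rewrite -expRD mulNr subrr expR0.
    by rewrite -[RHS]mulr1 -mE; ring.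
  rewrite ler_peMr//.
    by rewrite mulr_ge0 ?divr_ge0 ?expR_ge0 ?ltW.
  by rewrite (le_trans _ (expR_ge1Dx _))// lerDl -mulNr mulr_ge0// oppr_ge0.
- exact: continuous_utility_loss.
Qed.

(** For v <= 0 even the customer who finds an empty system is infinitely unhappy,
    so the range of thresholds reduces to 0. *)
Lemma vrate_gt0_of_nhigh n0 : (0 < n0)%N ->
  (n0%:R%:E <= onat_ereal R (nhigh M))%E -> 0 < v.
Proof.
move=> n0_gt0 /onat_ereal_ge_first/(_ _ n0_gt0).
by apply: contraNT; rewrite -leNgt => v0; rewrite B0_ninfty.
Qed.

(** * Monotonicity of the expected utility *)

Context (vrate_gt0 : 0 < v) (cwait_gt0 : 0 < cwait M) (lcomp_ge0 : 0 <= l)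
  (lcomp_le : l <= cwait M).

Lemma vrate_le : v <= mu.
Proof. by rewrite /vrate gerBl mulr_ge0 ?subr_ge0 ?(ltW risk_gt0). Qed.

(** The two density terms at X = x cancel, because the compensation is
    continuous there; only the tail remains. *)
Lemma is_derive_waiting_factor n x : is_derive x 1 (waiting_factor M n)
  (r * l * (expR (r * l * x) * (mu / v) ^+ n.+1 * gamma_tail n v x)).
Proof.
have h := is_deriveD (is_deriveZ (mu ^+ n.+1 / (n`!)%:R)
    (is_derive_expint (r * cwait M - mu) n x))
  (is_deriveM (is_deriveM (is_derive_expRM (r * l) x)
     (is_derive_cst ((mu / v) ^+ n.+1) x 1)) (is_derive_gamma_tail n v x)).
apply: (is_derive_eq h); rewrite /GRing.scale /= !fctE.
have -> : expR ((r * cwait M - mu) * x) = expR (r * l * x) * expR (- (v * x)).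
  by rewrite -expRD /vrate; congr expR; ring.
rewrite /gamma_pdf expr_div_n.
have vn0 : v ^+ n.+1 != 0 by rewrite expf_neq0// gt_eqF.
by field; rewrite vn0 pnatr_eq0 -lt0n fact_gt0.
Qed.

Lemma is_derive_utility n x : is_derive x 1 (utility M n)
  (- (K * l * (expR (r * l * x) * (mu / v) ^+ n.+1 * gamma_tail n v x))).
Proof.
have h := is_deriveZ r^-1 (is_deriveB (is_derive_cst (1 : R) x 1)
  (is_deriveZ K (is_derive_waiting_factor n x))).
have -> : utility M n = r^-1 \*: (cst 1 - K \*: waiting_factor M n).
  by apply/funext => y; rewrite /utility mulrC.
apply: (is_derive_eq h); rewrite /GRing.scale /=.
by field; rewrite gt_eqF.
Qed.

Lemma utility0 n : utility M n 0 = (1 - K * (mu / v) ^+ n.+1) / r.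
Proof.
by rewrite /utility /waiting_factor expint0 gamma_tailE0 !mulr0 expR0 add0r mul1r mulr1.
Qed.

Let utility_slope_ge0 n x : 0 <= x -> 0 <= K * l * (expR (r * l * x) * (mu / v) ^+ n.+1 * gamma_tail n v x).
Proof.
move=> x0; apply: mulr_ge0; first by rewrite mulr_ge0 ?expR_ge0.
apply: mulr_ge0; last exact: gamma_tail_ge0 (ltW vrate_gt0) x0.
by rewrite mulr_ge0 ?expR_ge0 ?exprn_ge0 ?divr_ge0 ?(ltW mu_gt0) ?(ltW vrate_gt0).
Qed.

Lemma utility_nincr n x y : 0 <= x -> x <= y -> utility M n y <= utility M n x.
Proof.
move=> x0 xy; apply: (is_derive_ger (fun z _ => is_derive_utility n z)) => // z /andP[xz _].
by rewrite oppr_le0 utility_slope_ge0// (le_trans x0)// ltW.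
Qed.

Lemma utility_decr n x y : 0 < l -> 0 <= x -> x < y -> utility M n y < utility M n x.
Proof.
move=> l0 x0 xy; apply: (is_derive_gtr (fun z _ => is_derive_utility n z)) => // z /andP[xz _].
rewrite oppr_lt0; apply: mulr_gt0; first by rewrite mulr_gt0 ?expR_gt0.
apply: mulr_gt0; first by rewrite mulr_gt0 ?expR_gt0 ?exprn_gt0 ?divr_gt0.
by rewrite gamma_tail_gt0 ?(ltW vrate_gt0)// (le_trans x0)// ltW.
Qed.

Lemma utility_const n x y : l = 0 -> utility M n x = utility M n y.
Proof.
move=> l0.
wlog xy : x y / x <= y.
  by move=> h; have [/h//|/ltW/h] := leP x y.
apply/eqP; rewrite eq_le; apply/andP; split.
- apply: (is_derive_ler (fun z _ => is_derive_utility n z)) => // z _.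
  by rewrite l0 mulr0 mul0r oppr0.
- apply: (is_derive_ger (fun z _ => is_derive_utility n z)) => // z _.
  by rewrite l0 mulr0 mul0r oppr0.
Qed.

(** One more customer ahead means one more service time to wait for.  The gap is
    nonnegative at x = 0 since v <= mu, and it grows with x by comparison of
    Gamma tails. *)
Let delay_gap n x := waiting_factor M n.+1 x - waiting_factor M n x.

Let is_derive_delay_gap n x : is_derive x 1 (delay_gap n)
  (r * l * (expR (r * l * x) * (mu / v) ^+ n.+1) *
    (mu / v * gamma_tail n.+1 v x - gamma_tail n v x)).
Proof.
have h := is_deriveB (is_derive_waiting_factor n.+1 x) (is_derive_waiting_factor n x).
by apply: (is_derive_eq h); rewrite [_ ^+ n.+2]exprS; ring.
Qed.

Let muv_ge1 : 1 <= mu / v.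
Proof. by rewrite ler_pdivlMr// mul1r vrate_le. Qed.

Let delay_gap0 n : delay_gap n 0 = (mu / v) ^+ n.+1 * (mu / v - 1).
Proof.
rewrite /delay_gap /waiting_factor !expint0 !gamma_tailE0 !mulr0 !expR0.
by rewrite [_ ^+ n.+2]exprS; ring.
Qed.

Let delay_gap0_ge0 n : 0 <= delay_gap n 0.
Proof. by rewrite delay_gap0 mulr_ge0 ?subr_ge0// exprn_ge0// divr_ge0 ?ltW. Qed.

Let delay_gap_ler n x : 0 <= x -> delay_gap n 0 <= delay_gap n x.
Proof.
move=> x0; apply: (is_derive_ler (fun z _ => is_derive_delay_gap n z)) => // z /andP[/ltW z0 _].
apply: mulr_ge0.
  by rewrite !mulr_ge0 ?expR_ge0 ?exprn_ge0 ?divr_ge0 ?(ltW mu_gt0) ?(ltW vrate_gt0) ?(ltW risk_gt0).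
rewrite subr_ge0 -[leLHS]mul1r ler_pM ?gamma_tail_le ?(ltW vrate_gt0)//.
by rewrite gamma_tail_ge0 ?(ltW vrate_gt0).
Qed.

Lemma utility_ler_succ n x : 0 <= x -> utility M n.+1 x <= utility M n x.
Proof.
move=> x0; rewrite /utility ler_pM2r ?invr_gt0// lerD2l lerN2 ler_pM2l ?expR_gt0//.
by rewrite -subr_ge0 -/(delay_gap n x) (le_trans _ (delay_gap_ler _ x0)).
Qed.

(** For l = c and x = 0 the waiting costs are fully refunded and the utility is
    the same in all states, so the side condition cannot be dropped. *)
Lemma utility_ltr_succ n x : 0 <= x -> 0 < x \/ l < cwait M -> utility M n.+1 x < utility M n x.
Proof.
move=> x0 xl; rewrite /utility ltr_pM2r ?invr_gt0// ltrD2l ltrN2 ltr_pM2l ?expR_gt0//.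
rewrite -subr_gt0 -/(delay_gap n x).
have [vlt|] := boolP (l < cwait M).
  apply: lt_le_trans (delay_gap_ler _ x0); rewrite delay_gap0.
  rewrite mulr_gt0 ?exprn_gt0 ?divr_gt0// subr_gt0 ltr_pdivlMr// mul1r.
  by rewrite /vrate ltrBlDr ltrDl mulr_gt0 ?subr_gt0.
rewrite -leNgt => lc; have l0 : 0 < l by exact: lt_le_trans lc.
have xgt0 : 0 < x by case: xl => //; rewrite ltNge lc.
apply: le_lt_trans (delay_gap0_ge0 n) _.
apply: (is_derive_ltr (fun z _ => is_derive_delay_gap n z)) => // z /andP[z0 _].
rewrite !mulr_gt0 ?expR_gt0 ?exprn_gt0 ?divr_gt0// subr_gt0.
apply: lt_le_trans (gamma_tail_lt _ _ _) _ => //.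
by rewrite ler_peMl// gamma_tail_ge0 ?ltW.
Qed.

Lemma utility_ler_n m n x : (m <= n)%N -> 0 <= x -> utility M n x <= utility M m x.
Proof.
move=> mn x0; elim: n mn => [|n IHn]; first by rewrite leqn0 => /eqP ->.
rewrite leq_eqVlt => /predU1P[->//|]; rewrite ltnS => /IHn.
exact/le_trans/utility_ler_succ.
Qed.

(** For a negative growth rate the primitive is an incomplete Gamma function;
    both sides have the same derivative and vanish at 0. *)
Let expint_gamma_tail theta n x : 0 < theta -> 0 <= x -> expint (- theta) n x =
  (n`!)%:R / theta ^+ n.+1 * (1 - gamma_tail n theta x).
Proof.
move=> theta0 x0; have tn0 : theta ^+ n.+1 != 0 by rewrite expf_neq0// gt_eqF.
have nf0 : (n`!)%:R != 0 :> R by rewrite pnatr_eq0 -lt0n fact_gt0.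
pose D (y : R) := expint (- theta) n y - (n`!)%:R / theta ^+ n.+1 *: (1 - gamma_tail n theta y).
have dD (y : R) : is_derive y 1 D 0.
  have h := is_deriveB (is_derive_expint (- theta) n y)
    (is_deriveZ ((n`!)%:R / theta ^+ n.+1)
    (is_deriveB (is_derive_cst (1 : R) y 1) (is_derive_gamma_tail n theta y))).
  apply: (is_derive_eq h); rewrite /GRing.scale /= gamma_pdfE.
  by field; rewrite nf0 tn0.
have D0 : D 0 = 0.
  by rewrite /D expint0 gamma_tailE0 subrr scaler0 subrr.
have : D x = 0.
  apply/eqP; rewrite eq_le -D0.
  by rewrite (is_derive_ger (fun z _ => dD z))// (is_derive_ler (fun z _ => dD z)).
by move=> /eqP; rewrite subr_eq0 => /eqP ->.
Qed.

Lemma cvg_utility n : r * cwait M < mu -> utility M n x @[x --> +oo] --> utility_infty M n.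
Proof.
move=> rc; have k0 : 0 < mu - r * cwait M by rewrite subr_gt0.
set k := mu - r * cwait M in k0 *.
have rlv : r * l = v - k by rewrite /k /vrate; ring.
have kv : k <= v by rewrite -subr_ge0 -rlv mulr_ge0 ?(ltW risk_gt0).
have h1 : expR (r * l * x) * gamma_tail n v x @[x --> +oo] --> 0.
  apply: (@squeeze_cvgr _ _ _ _ (cst 0) (fun x =>
    (v / k) ^+ n * gamma_tail n k x)); last 2 first.
  - exact: cvg_cst.
  - by rewrite -[X in _ --> X](mulr0 ((v / k) ^+ n)); apply: cvgMr; exact: cvg_gamma_tail.
  near=> x.
  have x0 : 0 <= x by [].
  rewrite /cst mulr_ge0 ?expR_ge0 ?gamma_tail_ge0 ?(ltW vrate_gt0)//= /gamma_tail mulrA -expRD.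
  have -> : r * l * x - v * x = - (k * x) by rewrite rlv; ring.
  rewrite mulrCA ler_pM2l ?expR_gt0// mulr_sumr; apply: ler_sum => i _.
  rewrite mulrA ler_wpM2r ?invr_ge0//.
  have -> : v * x = (v / k) * (k * x) by field; rewrite gt_eqF.
  rewrite exprMn ler_wpM2r ?exprn_ge0 ?mulr_ge0 ?(ltW k0)//.
  by rewrite ler_weXn2l ?ler_pdivlMr ?mul1r// -ltnS.
have h2 : waiting_factor M n x @[x --> +oo] --> (mu / k) ^+ n.+1.
  have h3 : (mu / k) ^+ n.+1 * (1 - gamma_tail n k x) + (mu / v) ^+ n.+1 *
     (expR (r * l * x) * gamma_tail n v x) @[x --> +oo] --> (mu / k) ^+ n.+1.
    rewrite -[X in _ --> X]addr0; apply: cvgD; last first.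
      by rewrite -[X in _ --> X](mulr0 ((mu / v) ^+ n.+1)); apply: cvgMr.
    rewrite -[X in _ --> X]mulr1; apply: cvgMr; rewrite -[X in _ --> X]subr0.
    by apply: cvgB; [exact: cvg_cst|exact: cvg_gamma_tail].
  apply: cvg_trans h3; apply: near_eq_cvg; near=> x.
  have x0 : 0 <= x by [].
  rewrite /waiting_factor (_ : r * cwait M - mu = - k); last by rewrite /k; ring.
  rewrite expint_gamma_tail// expr_div_n.
  have kn0 : k ^+ n.+1 != 0 by rewrite expf_neq0// gt_eqF.
  by field; rewrite kn0 pnatr_eq0 -lt0n fact_gt0 ?gt_eqF.
apply: cvgM; last exact: cvg_cst.
apply: cvgB; first exact: cvg_cst.
by apply: cvgMr.
Unshelve. all: by end_near. Qed.

(** For r c >= mu the integrand of [expint] is at least x^n, so the disutility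
    grows at least linearly in x. *)
Lemma cvg_utility_ninfty n : mu <= r * cwait M -> utility M n x @[x --> +oo] --> -oo.
Proof.
move=> rc.
have nf0 : 0 < (n`!)%:R :> R by rewrite ltr0n fact_gt0.
have c0 : 0 < K * (mu ^+ n.+1 / (n`!)%:R) / n.+1%:R.
  by rewrite divr_gt0// mulr_gt0 ?expR_gt0 ?divr_gt0 ?exprn_gt0.
set c := _ / n.+1%:R in c0.
have hint x : 0 <= x -> n.+1%:R^-1 * x ^+ n.+1 <= expint (r * cwait M - mu) n x.
  move=> x0; pose D (y : R) := expint (r * cwait M - mu) n y - n.+1%:R^-1 *: y ^+ n.+1.
  suff : D 0 <= D x by rewrite /D expint0 exprS mul0r scaler0 subrr subr_ge0.
  have dD y := is_deriveB (is_derive_expint (r * cwait M - mu) n y)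
    (is_deriveZ n.+1%:R^-1 (is_derive_exprn n.+1 y)).
  apply: (is_derive_ler (fun z _ => dD z)) => // y /andP[/ltW y0 _].
  rewrite /GRing.scale /= mulKf ?pnatr_eq0// subr_ge0 ler_peMr ?exprn_ge0//.
  by rewrite (le_trans _ (expR_ge1Dx _))// lerDl mulr_ge0// subr_ge0.
apply/cvgrNyPle => A; near=> x.
have x1 : 1 <= x by [].
have x0 : 0 <= x by rewrite (le_trans _ x1).
have xA : (1 - r * A) / c <= x by [].
rewrite /utility ler_pdivrMr// lerBlDr -lerBlDl mulrC.
move: xA; rewrite ler_pdivrMr// => /le_trans; apply.
rewrite /c -!mulrA [x * _]mulrC -!mulrA ler_pM2l ?expR_gt0// /waiting_factor.
apply: le_trans (_ : _ <= mu ^+ n.+1 / (n`!)%:R * expint (r * cwait M - mu) n x) _.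
  rewrite mulrA ler_pM2l ?divr_gt0 ?exprn_gt0//; apply: le_trans (hint _ x0).
  by rewrite ler_pM2l ?invr_gt0// exprS ler_peMr// exprn_ege1.
rewrite lerDl; apply: mulr_ge0; last by rewrite gamma_tail_ge0 ?(ltW vrate_gt0).
by rewrite mulr_ge0 ?expR_ge0 ?exprn_ge0 ?divr_ge0 ?(ltW mu_gt0) ?(ltW vrate_gt0).
Unshelve. all: by end_near. Qed.

(** The limit in the definition of [nlow] is the value at the quote +oo, whether
    this value is finite or not. *)
Lemma cvg_B n : B M n x%:E @[x --> +oo] --> B M n +oo%E.
Proof.
have h : (utility M n x)%:E @[x --> +oo] --> B M n +oo%E.
  have [rc|rc] := leP mu (r * cwait M).
    by rewrite B_infty_ninfty//; apply/cvgerNyP; exact: cvg_utility_ninfty.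
  rewrite B_infty//; apply: cvg_EFin; first exact: nearW.
  exact: cvg_utility.
apply: cvg_trans h; apply: near_eq_cvg; near=> x.
by rewrite B_utility.
Unshelve. all: by end_near. Qed.

Lemma B_infty_le n x : 0 <= x -> (B M n +oo <= (utility M n x)%:E)%E.
Proof.
move=> x0; apply: cvge_to_le (@cvg_B n) _.
near=> y; have xy : x <= y by [].
by rewrite B_utility ?(le_trans x0 xy)// lee_fin utility_nincr.
Unshelve. all: by end_near. Qed.

Lemma B_infty_ge0 n : (0 <= B M n +oo)%E <-> forall x, 0 <= x -> 0 <= utility M n x.
Proof.
split=> [B0 x x0|B0].
  by rewrite -lee_fin (le_trans B0)// B_infty_le.
apply: cvge_to_ge (@cvg_B n) _.
by near=> y; rewrite B_utility// lee_fin B0.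
Unshelve. all: by end_near. Qed.

Lemma lim_B n : lim (B M n x%:E @[x --> +oo]) = B M n +oo%E.
Proof. by apply/cvg_lim => //; exact: cvg_B. Qed.

Lemma B_ge0_le_n m n d : (0 <= d)%E -> (m <= n)%N -> (0 <= B M n d)%E -> (0 <= B M m d)%E.
Proof.
case: d => [d| |] //; last first.
  move=> _ mn /B_infty_ge0 B0; apply/B_infty_ge0 => x x0.
  by rewrite (le_trans (B0 _ x0))// utility_ler_n.
rewrite lee_fin => d0 mn; rewrite !B_utility// !lee_fin => /le_trans; apply.
exact: utility_ler_n.
Qed.

(** * Thresholds and feasible quotes *)

(** As the sign of the utility is monotone in n, two states decide. *)
Lemma balkP n d : (0 < n)%N -> (0 <= d)%E ->
  balk M d = Some n <-> (B M n d < 0)%E /\ (0 <= B M n.-1 d)%E.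
Proof.
move=> n0 d0; rewrite /balk first_nat_SomeP; split=> -[Bn Bm]; split=> //.
  by rewrite leNgt; apply: Bm; rewrite prednK.
move=> m mn; rewrite -leNgt; apply: B_ge0_le_n Bm => //.
by rewrite -ltnS prednK.
Qed.

(** For l = 0 the utility does not depend on the quote, so a finite nonnegative
    threshold forces l > 0. *)
Lemma dP_cases n :
  [\/ utility M n 0 < 0 /\ dP M n = (-1)%:E,
      exists z, [/\ 0 <= z, 0 < l, utility M n z = 0 & dP M n = z%:E]
    | (forall x, 0 <= x -> 0 <= utility M n x) /\ dP M n = +oo%E].
Proof.
rewrite /dP; set A := [set d | _].
have [B0|B0] := ltP (utility M n 0) 0.
  apply: Or31; split=> //; case: asboolP => // -[]; apply/seteqP; split=> // d [d0].
  case: d d0 => [d| |] // d0.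
    rewrite lee_fin in d0; rewrite B_utility// lee_fin => Bd.
    by move: B0; rewrite ltNge (le_trans Bd)// utility_nincr.
  by move=> /B_infty_ge0/(_ 0 (lexx _)); rewrite leNgt B0.
have A0 : A 0%E by split=> //; rewrite B_utility// lee_fin.
case: asboolP => [AE|_]; first by move: A0; rewrite AE.
have [Bge0|] := pselect (forall x, 0 <= x -> 0 <= utility M n x).
  apply: Or33; split=> //; apply/eqP; rewrite -leye_eq; apply: ereal_sup_ubound.
  by split=> //; exact/B_infty_ge0.
move=> /existsNP[y /not_implyP[y0 /negP]]; rewrite -ltNge => By.
have l0 : 0 < l.
  rewrite lt_neqAle lcomp_ge0 andbT; apply/eqP => /esym l0.
  by move: By; rewrite (utility_const n y 0 l0) ltNge B0.
have [z] : exists2 z, z \in `[0, y] & utility M n z = 0.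
  apply: IVT => //; last by rewrite ge_min le_max B0 (ltW By) orbT.
  apply: continuous_subspaceT.
  exact: (is_derive_continuous (is_derive_utility n)).
rewrite in_itv/= => /andP[z0 zy] Bz; apply: Or32; exists z; split=> //.
apply/eqP; rewrite eq_le; apply/andP; split; last first.
  by apply: ereal_sup_ubound; split; rewrite ?lee_fin// B_utility// Bz.
apply: ge_ereal_sup => -[d| |] //= [d0].
- rewrite lee_fin in d0; rewrite B_utility// !lee_fin => Bd.
  by rewrite leNgt; apply/negP => zd; move: Bd; rewrite leNgt -Bz utility_decr.
- by move=> /B_infty_ge0/(_ y y0); rewrite leNgt By.
- by move=> _; exact: leNye.
Qed.

Lemma lcomp_gt0_of_dP n : (0 <= dP M n)%E -> (dP M n < +oo)%E -> 0 < l.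
Proof.
case: (dP_cases n) => [[_ ->]|[z [_ l0 _ _]]|[_ ->]] //.
by rewrite lee_fin ler0N1.
Qed.

Lemma B_ge0_dP n d : (0 <= d)%E -> (0 <= B M n d)%E = (d <= dP M n)%E.
Proof.
move=> d0; apply/idP/idP.
  move=> Bd; rewrite /dP; case: asboolP => [E|_]; last exact: ereal_sup_ubound.
  suff : [set d | (0 <= d)%E /\ (0 <= B M n d)%E] d by rewrite E.
  by [].
case: (dP_cases n) => [[_ ->]|[z [z0 _ Bz ->]]|[B0 _]].
- by move=> /(le_trans d0); rewrite lee_fin ler0N1.
- case: d d0 => [d| |] //; rewrite !lee_fin => d0 dz.
  by rewrite B_utility// lee_fin -Bz utility_nincr.
- move=> _; case: d d0 => [d| |] //; last by move=> _; exact/B_infty_ge0.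
  by rewrite lee_fin => d0; rewrite B_utility// lee_fin B0.
Qed.

Lemma feasibleP n d : (0 < n)%N ->
  feasible M n d <-> [/\ (0 <= d)%E, (dP M n < d)%E & (d <= dP M n.-1)%E].
Proof.
move=> n0; split.
  move=> [d0 /(balkP n0 d0)[]]; rewrite ltNge !B_ge0_dP// -ltNge.
  by [].
move=> [d0 h1 h2]; split=> //; apply/balkP => //.
by rewrite ltNge !B_ge0_dP// -ltNge.
Qed.

(** * The marginal welfare a_c *)

Context (lam_gt0 : 0 < la) (N : nat) (N_gt0 : (0 < N)%N).

Let geom (z : R) : R := \sum_(k < N.+1) z ^+ k.

Let geom_gt0 z : 0 <= z -> 0 < geom z.
Proof.
by move=> z0; rewrite /geom big_ord_recl/= expr0 ltr_pwDl// sumr_ge0// => i _; rewrite exprn_ge0.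
Qed.

Let rho_ge0 : 0 <= la / mu. Proof. by rewrite divr_ge0 ?ltW. Qed.
Let sigma_ge0 : 0 <= la / v. Proof. by rewrite divr_ge0 ?ltW. Qed.
Let sigmaE n : (la / v) ^+ n = (la / mu) ^+ n * (mu / v) ^+ n.
Proof. by rewrite -exprMn; congr (_ ^+ _); field; rewrite !gt_eqF. Qed.
Let vmu : v <= mu. Proof. exact: vrate_le. Qed.

(** Each factor of [beta_c] is a geometric sum or its inverse, and the value
    chosen at the removable singularity agrees with this. *)
Let geometric_factor th : 0 < th ->
  (if la == th then N.+1%:R / th else (1 - (la / th) ^+ N.+1) / (th - la)) = geom (la / th) / th.
Proof.
move=> th0; have th_neq0 : th != 0 by rewrite gt_eqF.
case: eqP => [->|/eqP lath].
  rewrite divff// /geom (eq_bigr (fun=> 1)); last by move=> i _; rewrite expr1n.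
  by rewrite sumr_const card_ord.
have : (la / th) ^+ N.+1 - 1 = (la / th - 1) * geom (la / th) by rewrite subrX1.
move=> /(canRL (subrK _)) ->; field.
by rewrite th_neq0 subr_eq0 eq_sym.
Qed.

Lemma beta_cE : beta_c M N = mu / v * (geom (la / v) / geom (la / mu)).
Proof.
rewrite /beta_c geometric_factor//.
have -> : (if la == mu then mu / N.+1%:R else (mu - la) / (1 - rho M ^+ N.+1)) =
    mu / geom (la / mu).
  have := geometric_factor mu_gt0; rewrite -/(rho M).
  case: ifP => _ h; rewrite -[LHS]invrK invf_div h invf_div //.
by rewrite /rho; ring.
Qed.

Lemma beta_c_gt0 : 0 < beta_c M N.
Proof. by rewrite beta_cE mulr_gt0 ?divr_gt0 ?geom_gt0. Qed.

Let scale := geom (la / v) / geom (la / mu).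

Let scale_gt0 : 0 < scale. Proof. by rewrite divr_gt0 ?geom_gt0. Qed.

(** The expression for [a_c_fin] on [0, oo[, without the maximum with 0 that
    makes it nondifferentiable at 0. *)
Let crit x : R := scale * (tail_ratio N la mu v x * expR (- (r * l * x))) - beta_c M N * K.

Let a_c_finE x : a_c_fin M N x =
  scale * (tail_ratio N la mu v (Num.max x 0) * expR (- (r * l * x))) - beta_c M N * K.
Proof.
rewrite /a_c_fin !sojourn_tailE// /scale /tail_ratio.
have u0 : unnormalized_tail N la v (Num.max x 0) != 0.
  by rewrite gt_eqF// unnormalized_tail_gt0// le_max lexx orbT.
rewrite -!/(geom _); congr (_ - _); field.
by rewrite u0 !gt_eqF ?geom_gt0.
Qed.

Let a_c_fin_crit x : 0 <= x -> a_c_fin M N x = crit x.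
Proof. by move=> x0; rewrite a_c_finE max_l. Qed.

Lemma a_c_fin_nincr x y : x <= y -> a_c_fin M N y <= a_c_fin M N x.
Proof.
move=> xy; rewrite !a_c_finE lerD2r ler_pM2l//.
have m0 z : 0 <= Num.max z 0 :> R by rewrite le_max lexx orbT.
rewrite ler_pM ?expR_ge0 ?(ltW (tail_ratio_gt0 _ _ _ _ _))//.
- by rewrite tail_ratio_nincr// ge_max le_max xy/= m0.
- by rewrite ler_expR lerN2 ler_wpM2l// mulr_ge0 ?(ltW risk_gt0).
Qed.

(** For l > 0 the factor exp(- r l x) decreases strictly.  For l = 0 it is
    constant, but then v < mu and the tail ratio decreases strictly on
    [0, oo[. *)
Lemma a_c_fin_decr x y : 0 < l \/ 0 <= x -> x < y -> a_c_fin M N y < a_c_fin M N x.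
Proof.
move=> lx xy; rewrite !a_c_finE ltrD2r ltr_pM2l//.
have m0 z : 0 <= Num.max z 0 :> R by rewrite le_max lexx orbT.
have [l0|l0] := ltP 0 l.
  apply: (@le_lt_trans _ _ (tail_ratio N la mu v (Num.max x 0) * expR (- (r * l * y)))).
    rewrite ler_wpM2r ?expR_ge0//.
    by rewrite tail_ratio_nincr// ge_max le_max ltW//= m0.
  by rewrite ltr_pM2l ?tail_ratio_gt0// ltr_expR ltrN2 ltr_pM2l// mulr_gt0.
have {}l0 : l = 0 by apply/eqP; rewrite eq_le l0.
have x0 : 0 <= x by case: lx => //; rewrite l0 ltxx.
rewrite l0 mulr0 !mul0r oppr0 expR0 !mulr1 !max_l// ?(le_trans x0 (ltW xy))//.
by rewrite tail_ratio_decr// /vrate l0 subr0 ltrBlDr ltrDl mulr_gt0.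
Qed.

Lemma a_c_fin_const x : l = 0 -> x <= 0 -> a_c_fin M N x = a_c_fin M N 0.
Proof. by move=> l0 x0; rewrite !a_c_finE l0 mulr0 !mul0r !max_r. Qed.

Let cvg_a_c_fin : a_c_fin M N x @[x --> +oo] --> - (beta_c M N * K).
Proof.
have h : crit x @[x --> +oo] --> - (beta_c M N * K).
  rewrite -[X in _ --> X]add0r; apply: cvgB; last exact: cvg_cst.
  rewrite -[X in _ --> X](mulr0 scale); apply: cvgMr.
  apply: cvg_tail_ratio_expR => //.
  have : 0 < r * cwait M by rewrite mulr_gt0.
  by rewrite /vrate; lra.
apply: cvg_trans h; apply: near_eq_cvg; near=> x.
by rewrite a_c_fin_crit.
Unshelve. all: by end_near. Qed.

Lemma a_c_infty : a_c M N +oo%E = - (beta_c M N * K).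
Proof.
by rewrite /a_c; apply/cvg_lim => //; exact: cvg_a_c_fin.
Qed.

Lemma a_c_infty_lt0 : a_c M N +oo%E < 0.
Proof. by rewrite a_c_infty oppr_lt0 mulr_gt0 ?beta_c_gt0 ?expR_gt0. Qed.

Lemma a_c_fin_eventually_lt0 x : exists2 y, x <= y & a_c_fin M N y < 0.
Proof.
have a0 : - (beta_c M N * K) < 0 by rewrite oppr_lt0 mulr_gt0 ?beta_c_gt0 ?expR_gt0.
have H : \forall y \near +oo, x <= y /\ a_c_fin M N y < 0.
  near=> y; split; first by [].
  by near: y; exact: (cvgr_lt _ cvg_a_c_fin).
by have [y [xy ay]] := filter_ex H; exists y.
Unshelve. all: by end_near. Qed.

Let is_derive_crit x : 0 <= x -> exists d : R, is_derive x 1 crit d.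
Proof.
move=> x0.
have h := is_deriveB (is_deriveZ scale (is_deriveM
  (is_derive_tail_ratio N_gt0 lam_gt0 mu_gt0 vrate_gt0 x0) (is_derive_expRM (- (r * l)) x)))
  (is_derive_cst (beta_c M N * K) x 1).
rewrite (_ : crit = scale \*: (tail_ratio N la mu v * (fun y => expR (- (r * l) * y)))
  - cst (beta_c M N * K)); first by eexists; exact: h.
by apply/funext => y; rewrite /crit -mulNr.
Qed.

Lemma a_c_fin_zero x y : 0 <= x -> x <= y -> 0 <= a_c_fin M N x -> a_c_fin M N y <= 0 ->
  exists2 z, x <= z <= y & a_c_fin M N z = 0.
Proof.
move=> x0 xy ax ay.
have cc : {within `[x, y], continuous crit}.
  apply: derivable_within_continuous => z; rewrite in_itv/= => /andP[xz _].
  by have [d dz] := is_derive_crit (le_trans x0 xz); case: dz.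
rewrite a_c_fin_crit// in ax; rewrite a_c_fin_crit ?(le_trans x0)// in ay.
have [|z] := IVT (v := 0) xy cc.
  by rewrite ge_min le_max ay ax orbT.
rewrite in_itv/= => /andP[xz zy] cz; exists z; first by rewrite xz.
by rewrite a_c_fin_crit// (le_trans x0).
Qed.

(** Up to a positive factor, a_c(0) is the sum over n < N of
    rho^n (1 - K (mu/v)^(n+1)), whose terms have the sign of B_n(0). *)
Lemma a_c_fin0_ge0 : (forall n, (n < N)%N -> 0 <= utility M n 0) -> 0 <= a_c_fin M N 0.
Proof.
move=> B0; rewrite a_c_fin_crit// /crit mulr0 oppr0 expR0 mulr1 beta_cE -/scale.
have -> : scale * tail_ratio N la mu v 0 - mu / v * scale * K =
  scale * (tail_ratio N la mu v 0 - mu / v * K) by ring.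
rewrite mulr_ge0 ?(ltW scale_gt0)// subr_ge0.
rewrite /tail_ratio ler_pdivlMr ?unnormalized_tail_gt0// /unnormalized_tail mulr_sumr.
apply: ler_sum => n _; rewrite !gamma_tailE0 !mulr1 sigmaE mulrCA ler_piMr ?exprn_ge0//.
have := B0 n (ltn_ord n); rewrite utility0 pmulr_lge0 ?invr_gt0// subr_ge0.
by rewrite exprS; apply: le_trans; rewrite le_eqVlt; apply/orP; left; apply/eqP; ring.
Qed.

(** The factor in front of a_c is positive on [0, oo[ for l > 0, so the sign of
    a_c governs the monotonicity of the welfare. *)
Lemma is_derive_welfare (d : R) : 0 <= d -> is_derive d 1 (welfare M N)
  (la * l * (unnormalized_tail N la v d / geom (la / v)) * expR (r * l * d) * a_c_fin M N d).
Proof.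
move=> d0.
have h := is_deriveZ la (is_derive_sum (fun n : 'I_N => is_deriveZ (qst (rho M) n N)
  (is_deriveD (is_deriveB (is_derive_cst (fee M) d 1)
     (is_deriveZ l (is_derive_mean_excess n d mu_gt0)))
   (is_derive_utility n d)))).
rewrite (_ : welfare M N = la \*: \sum_(n < N) qst (rho M) n N \*:
    (cst (fee M) - l \*: mean_excess n mu + utility M n)); last first.
  apply/funext => y; rewrite /welfare.
  rewrite -[RHS]/(la * (\sum_(n < N) qst (rho M) n N \*:
    (cst (fee M) - l \*: mean_excess n mu + utility M n)) y) fct_sumE; congr (_ * _).
apply: (is_derive_eq h); rewrite a_c_fin_crit// /crit beta_cE -/scale.
have u0 : unnormalized_tail N la v d != 0 by rewrite gt_eqF// unnormalized_tail_gt0.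
have -> : la * l * (unnormalized_tail N la v d / geom (la / v)) * expR (r * l * d) *
    (scale * (tail_ratio N la mu v d * expR (- (r * l * d))) - mu / v * scale * K) =
  la * (l / geom (la / mu) * (unnormalized_tail N la mu d -
    K * expR (r * l * d) * (mu / v) * unnormalized_tail N la v d)).
  rewrite expRN /scale /tail_ratio; field.
  by rewrite u0 !gt_eqF ?geom_gt0 ?expR_gt0.
rewrite /GRing.scale /=; congr (_ * _).
rewrite /unnormalized_tail !mulr_sumr -sumrB mulr_sumr; apply: eq_bigr => n _.
rewrite sigmaE /qst -/(geom (rho M)) -/(rho M) [_ ^+ n.+1]exprS sub0r mulrN opprK.
by ring.
Qed.

Let welfare_weight_gt0 (d : R) : 0 < l -> 0 <= d ->
  0 < la * l * (unnormalized_tail N la v d / geom (la / v)) * expR (r * l * d).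
Proof.
move=> l0 d0; rewrite !mulr_gt0 ?invr_gt0 ?expR_gt0 ?geom_gt0//.
exact: unnormalized_tail_gt0.
Qed.

Lemma welfare_incr x y : 0 < l -> 0 <= x -> x < y -> 0 <= a_c_fin M N y ->
  welfare M N x < welfare M N y.
Proof.
move=> l0 x0 xy ay; apply: is_derive_ltr xy _ => z /andP[xz zy].
  by apply: is_derive_welfare; exact: le_trans xz.
have z0 : 0 <= z by rewrite (le_trans x0)// ltW.
by rewrite mulr_gt0 ?welfare_weight_gt0// (le_lt_trans ay)// a_c_fin_decr//; right.
Qed.

Lemma welfare_decr x y : 0 < l -> 0 <= x -> x < y -> a_c_fin M N x <= 0 ->
  welfare M N y < welfare M N x.
Proof.
move=> l0 x0 xy ax; apply: is_derive_gtr xy _ => z /andP[xz zy].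
  by apply: is_derive_welfare; exact: le_trans xz.
have z0 : 0 <= z by rewrite (le_trans x0)// ltW.
by rewrite pmulr_rlt0 ?welfare_weight_gt0// (lt_le_trans _ ax)// a_c_fin_decr//; right.
Qed.

Lemma welfare_const x : l = 0 -> 0 <= x -> welfare M N x = welfare M N 0.
Proof.
move=> l0 x0.
have dw z : 0 <= z <= x -> is_derive z 1 (welfare M N) 0.
  move=> /andP[z0 _]; apply: (is_derive_eq (is_derive_welfare z0)).
  by rewrite l0 mulr0 !mul0r.
by apply/eqP; rewrite eq_le (is_derive_ger dw)// (is_derive_ler dw).
Qed.

(** * The social benefit of feasible quotes *)

Lemma L_infty n : L M n +oo%E = 0%E.
Proof.
rewrite /L /Egamma (eq_integral (cst 0%E)) ?integral0// => x _.
by rewrite delay_infty mul0r.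
Qed.

Let feasible_B_ge0 d n : feasible M N d -> (n < N)%N -> (0 <= B M n d)%E.
Proof.
move=> [d0 /first_nat_SomeP[_ h]] nN.
by rewrite leNgt; exact: h.
Qed.

Lemma Sc_feasible x : feasible M N x%:E -> Sc M x%:E = (welfare M N x)%:E.
Proof.
move=> fx; have [x0 bx] := fx; rewrite /Sc bx /welfare EFinM -sumEFin.
congr (_ * _)%E; apply: eq_bigr => n _.
rewrite /G (feasible_B_ge0 fx)// /L Egamma_delay// B_utility//.
Qed.

(** If +oo is feasible then B_0(+oo) >= 0, which forces r c < mu and hence the
    convergence of all the utilities involved. *)
Lemma Sc_feasible_infty : feasible M N +oo%E ->
  exists2 s, Sc M +oo%E = s%:E & welfare M N x @[x --> +oo] --> s.
Proof.
move=> fy; have [_ by_] := fy.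
have rc : r * cwait M < mu.
  rewrite ltNge; apply/negP => rc.
  by have := feasible_B_ge0 fy N_gt0; rewrite B_infty_ninfty.
exists (la * \sum_(n < N) qst (rho M) n N * (fee M - l * 0 + utility_infty M n)).
  rewrite /Sc by_ EFinM -sumEFin.
  congr (_ * _)%E; apply: eq_bigr => n _.
  by rewrite /G (feasible_B_ge0 fy)// L_infty B_infty// mule0 mulr0 sube0 subr0.
apply: cvgMr; apply: cvg_big => [|n _]; first exact: add_continuous.
apply: cvgMr; apply: cvgD; last exact: cvg_utility.
apply: cvgB; first exact: cvg_cst.
by apply: cvgMr; exact: cvg_mean_excess.
Qed.

Lemma Sc_fin_num d : feasible M N d -> Sc M d \is a fin_num.
Proof.
case: d => [x| |] fd; [by rewrite Sc_feasible| |by case: fd].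
by have [s ->] := Sc_feasible_infty fd.
Qed.

Lemma Sc_incr d1 d2 : 0 < l -> feasible M N d1 -> feasible M N d2 ->
  (d1 < d2)%E -> 0 <= a_c M N d2 -> (Sc M d1 < Sc M d2)%E.
Proof.
move=> l0 f1 f2 d12 a2.
case: d2 d12 f2 a2 => [y| |] d12 f2 a2; last by case: f2.
  case: d1 d12 f1 => [x| |] // d12 f1; last by case: f1.
  have x0 : 0 <= x by case: f1; rewrite lee_fin.
  by rewrite !Sc_feasible// lte_fin welfare_incr.
by move: a2; rewrite leNgt a_c_infty_lt0.
Qed.

(** The point x need not be feasible: it may be the excluded left end of the
    interval of feasible quotes. *)
Lemma Sc_lt_welfare x d : 0 < l -> 0 <= x -> a_c_fin M N x <= 0 ->
  feasible M N d -> (x%:E < d)%E -> (Sc M d < (welfare M N x)%:E)%E.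
Proof.
move=> l0 x0 ax; case: d => [y| |] fd xd; last by case: fd.
  by rewrite Sc_feasible// lte_fin welfare_decr.
have [s -> ws] := Sc_feasible_infty fd; rewrite lte_fin.
apply: (@le_lt_trans _ _ (welfare M N (x + 1))); last by rewrite welfare_decr// ltrDl.
apply: cvgr_to_le ws _; near=> y.
have xy : x + 1 < y by near: y; apply: nbhs_pinfty_gt; rewrite num_real.
rewrite ltW// welfare_decr// ?addr_ge0//.
by apply: le_trans ax; rewrite a_c_fin_nincr// lerDl.
Unshelve. all: by end_near. Qed.

Lemma Sc_decr d1 d2 : 0 < l -> feasible M N d1 -> feasible M N d2 ->
  (d1 < d2)%E -> a_c M N d1 <= 0 -> (Sc M d2 < Sc M d1)%E.
Proof.
move=> l0 f1 f2 d12; case: d1 d12 f1 => [x| |] d12 f1 a1; last by case: f1.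
  rewrite (Sc_feasible f1); apply: Sc_lt_welfare => //.
  by case: f1; rewrite lee_fin.
by move: d12; rewrite ltNge leey.
Qed.

Lemma Sc_const d1 d2 : l = 0 -> feasible M N d1 -> feasible M N d2 ->
  Sc M d1 = Sc M d2.
Proof.
move=> l0.
suff h d : feasible M N d -> Sc M d = (welfare M N 0)%:E by move=> /h -> /h ->.
case: d => [x| |] fx; last by case: fx.
  by rewrite Sc_feasible// welfare_const//; case: fx; rewrite lee_fin.
have [s -> ws] := Sc_feasible_infty fx.
congr _%:E; apply: (cvg_unique _ ws) => //.
have h : (fun _ : R => welfare M N 0) x @[x --> +oo] --> welfare M N 0 by exact: cvg_cst.
apply: cvg_trans h; apply: near_eq_cvg; near=> y.
by rewrite welfare_const.
Unshelve. all: by end_near. Qed.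

Lemma max_optimal d : feasible M N d ->
  (forall d', feasible M N d' -> (Sc M d' <= Sc M d)%E) -> optimal M N d.
Proof.
move=> fd dmax; split=> //; apply/eqP; rewrite eq_le; apply/andP; split.
  by apply: ereal_sup_ubound; exists d.
by apply: ge_ereal_sup => _ [d' fd' <-]; exact: dmax.
Qed.

Lemma strict_max_optimal d : feasible M N d ->
  (forall d', feasible M N d' -> d' != d -> (Sc M d' < Sc M d)%E) ->
  optimal M N d /\ (forall d', optimal M N d' -> d' = d).
Proof.
move=> fd dmax.
have od : optimal M N d.
  apply: (max_optimal fd) => d' fd'.
  by case: (eqVneq d' d) => [->|/(dmax _ fd')]; [exact: lexx|exact: ltW].
split=> // d' [fd' Sd']; apply/eqP; apply: contraT => /(dmax _ fd').
by case: od => _ ->; rewrite Sd' ltxx.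
Qed.

(** The conditions on d are vacuous on a side where there is no feasible
    quote, so d may be an end of the interval. *)
Lemma sign_change_is_dSc d : feasible M N d ->
  (forall d', feasible M N d' -> (d' < d)%E -> 0 <= a_c M N d) ->
  (forall d', feasible M N d' -> (d < d')%E -> a_c M N d <= 0) ->
  is_dSc M N d.
Proof.
move=> fd ad_ge0 ad_le0; have [l0|l0] := ltP 0 l.
  have [|? ?] := strict_max_optimal fd; last by split.
  move=> d' fd'; rewrite neq_lt => /orP[d'd|dd'].
    exact: Sc_incr (ad_ge0 _ fd' d'd).
  exact: Sc_decr (ad_le0 _ fd' dd').
have {}l0 : l = 0 by apply/eqP; rewrite eq_le l0.
split; last by rewrite l0 ltxx.
by apply: (max_optimal fd) => d' fd'; rewrite (Sc_const l0 fd' fd).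
Qed.

(** * The three cases *)

Context (N_low : (onat_ereal R (nlow M) <= N%:R%:E)%E)
  (N_high : (N%:R%:E <= onat_ereal R (nhigh M))%E)
  (nondegenerate : l < cwait M \/ fee M < reward M).

Lemma B0_ge0 n : (n < N)%N -> (0 <= B M n 0)%E.
Proof. by move=> nN; rewrite leNgt; move/onat_ereal_ge_first : N_high; apply. Qed.

Lemma B_infty_lt0 : (B M N +oo < 0)%E.
Proof.
have [m mN] := (onat_ereal_le_first _ _ _).1 N_low.
rewrite lim_B// !ltNge; apply: contraNN => B0.
by apply: (@B_ge0_le_n m N) => //; rewrite leey.
Qed.

Lemma dP_lt_infty : (dP M N < +oo)%E.
Proof. by rewrite ltNge -B_ge0_dP// ?leey// -ltNge B_infty_lt0. Qed.

Lemma dP_pred_ge0 : (0 <= dP M N.-1)%E.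
Proof. by rewrite -B_ge0_dP// B0_ge0// prednK. Qed.

(** If N is the least state in which a customer without compensation balks,
    the customer in state N - 1 joins for every quote, and the convention
    d = +oo is the value of the supremum. *)
Lemma dP_predE : dP_pred M N = dP M N.-1.
Proof.
rewrite /dP_pred; case: eqP => // /first_nat_SomeP[_ /(_ N.-1)].
rewrite prednK// => /(_ (leqnn _)); rewrite lim_B// -leNgt B_ge0_dP ?leey// leye_eq.
by move=> /eqP ->.
Qed.

(** Equal finite thresholds would be a common zero of two consecutive utilities;
    this needs the quote 0 and l = c, and then the utility at 0 is positive
    because the fee is below the service value. *)
Lemma dP_lt_pred : (dP M N < dP M N.-1)%E.
Proof.
case: (dP_cases N.-1) => // [[B0 _]|[z [z0 l0 Bz ->]]|[_ ->]]; last exact: dP_lt_infty.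
  by have := @B0_ge0 N.-1; rewrite prednK// => /(_ (leqnn _)); rewrite B_utility// lee_fin leNgt B0.
rewrite ltNge -B_ge0_dP ?lee_fin// B_utility// lee_fin -ltNge -Bz.
rewrite -{1}(prednK N_gt0) utility_ltr_succ//.
have [lc|lc] := ltP l (cwait M); first by right.
left; rewrite lt_neqAle z0 andbT; apply/eqP => z00; move: Bz; rewrite -z00 utility0.
have -> : v = mu.
  by rewrite /vrate (_ : cwait M - l = 0) ?mulr0 ?subr0//; apply/eqP; rewrite subr_eq0 eq_le lc lcomp_le.
rewrite divff ?gt_eqF// expr1n mulr1 => /eqP.
rewrite mulf_eq0 invr_eq0 (gt_eqF risk_gt0) orbF subr_eq0 eq_sym => /eqP K1.
have : expR (- (r * (reward M - fee M))) < 1.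
  rewrite expR_lt1 oppr_lt0 mulr_gt0// subr_gt0.
  by case: nondegenerate => //; rewrite ltNge lc.
by rewrite K1 ltxx.
Qed.

Lemma nhigh_of_dP : (dP M N < 0)%E -> nhigh M = Some N.
Proof.
move=> dP0; apply/first_nat_SomeP; split.
  by rewrite ltNge B_ge0_dP// -ltNge.
by move=> m mN; rewrite -leNgt B0_ge0.
Qed.

Lemma feasible_dP_pred : feasible M N (dP M N.-1).
Proof. by apply/feasibleP => //; split; [exact: dP_pred_ge0|exact: dP_lt_pred|]. Qed.

Let lo_cases :
  dP M N = (-1)%:E \/ exists z, [/\ 0 <= z, 0 < l & dP M N = z%:E].
Proof.
have := dP_lt_infty.
case: (dP_cases N) => [[_ ->]|[z [z0 l0 _ ->]]|[_ ->]] //; first by left.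
by right; exists z.
Qed.

(** S_c decreases over the whole interval.  Either the interval starts with the
    feasible quote 0, or every feasible quote is improved by a smaller one
    while S_c stays below its finite value at the left end. *)
Lemma optimum_of_nonpositive_at_dP : a_c M N (dP M N) <= 0 ->
     (nhigh M = Some N /\ is_dSc M N 0%E)
     \/ ((forall d : \bar R, ~ optimal M N d)
         /\ (forall d : \bar R,
               (0 <= d)%E -> (dP M N < d)%E -> (d <= dP_pred M N)%E ->
               Sc M d <> Zc M N)
         /\ eps_optimal_exist M N).
Proof.
case: lo_cases => [lo|[z [z0 l0 lo]]] alo; rewrite lo in alo.
  left; split; first by apply: nhigh_of_dP; rewrite lo lte_fin ltrN10.
  have f0 : feasible M N 0%E.
    by apply/feasibleP => //; split; [exact: lexx|rewrite lo lte_fin ltrN10|exact: dP_pred_ge0].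
  apply: (sign_change_is_dSc f0) => [d' [d'0 _]|_ _ _].
    by rewrite ltNge d'0.
  by apply: le_trans alo; rewrite a_c_fin_nincr// lerN10.
right.
have Sub d : feasible M N d -> (Sc M d < (welfare M N z)%:E)%E.
  move=> fd; apply: (Sc_lt_welfare l0 z0 alo fd).
  by rewrite -lo; case/(feasibleP _ N_gt0): fd.
have nopt d : ~ optimal M N d.
  move=> [fd Sd]; have [d0 dlo dhi] := (feasibleP _ N_gt0).1 fd.
  have [y /andP[zy yd]] : exists y, (z%:E < y%:E < d)%E.
    move: dlo; rewrite lo; case: (d) => [x| |] //.
      by rewrite lte_fin => zx; exists ((z + x) / 2); rewrite !lte_fin; apply/andP; split; lra.
    by move=> _; exists (z + 1); rewrite lte_fin ltrDl ltr01 ltry.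
  have zy' : z <= y by rewrite ltW// -lte_fin.
  have fy : feasible M N y%:E.
    apply/feasibleP => //; split; [|by rewrite lo|exact: le_trans (ltW yd) dhi].
    by rewrite lee_fin (le_trans z0).
  have ay : a_c M N y%:E <= 0 by apply: le_trans alo; exact: a_c_fin_nincr.
  have := Sc_decr l0 fy fd yd ay; rewrite Sd ltNge => /negP; apply.
  by apply: ereal_sup_ubound; exists y%:E.
split; first exact: nopt.
split.
  move=> d d0 dlo; rewrite dP_predE => dhi Sd; apply: (nopt d); split; last exact: Sd.
  by apply/feasibleP => //; split.
move=> e e0.
have Zfin : Zc M N \is a fin_num.
  rewrite fin_numE; apply/andP; split.
    rewrite gt_eqF//; apply: (@lt_le_trans _ _ (Sc M (dP M N.-1))).
      by have := Sc_fin_num feasible_dP_pred; rewrite fin_numE ltNye => /andP[].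
    by apply: ereal_sup_ubound; exists (dP M N.-1); first exact: feasible_dP_pred.
  rewrite lt_eqF//; apply: (@le_lt_trans _ _ (welfare M N z)%:E); last exact: ltry.
  by apply: ge_ereal_sup => _ [d fd <-]; exact/ltW/Sub.
by have [_ [d fd <-] h] := ub_ereal_sup_adherent e0 Zfin; exists d.
Qed.

(** As a_c is negative at +oo, the right end is finite, hence a zero of a
    nonconstant utility, so that l > 0 and S_c increases strictly. *)
Lemma optimum_of_nonnegative_at_dP_pred : 0 <= a_c M N (dP_pred M N) ->
     (dP_pred M N < +oo)%E
     /\ optimal M N (dP_pred M N)
     /\ (forall d : \bar R, optimal M N d -> d = dP_pred M N).
Proof.
rewrite dP_predE => az.
have zoo : (dP M N.-1 < +oo)%E.
  by rewrite ltNge leye_eq; apply/negP => /eqP E; move: az; rewrite E leNgt a_c_infty_lt0.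
have l0 : 0 < l := lcomp_gt0_of_dP dP_pred_ge0 zoo.
split; first exact: zoo.
apply: (strict_max_optimal feasible_dP_pred) => d' fd' d'z.
apply: (Sc_incr l0 fd' feasible_dP_pred _ az); rewrite lt_neqAle d'z /=.
by case/(feasibleP _ N_gt0): fd'.
Qed.

(** The zero of a_c is sought to the right of the nonnegative part of the left
    end.  When that end is -1, a negative zero is excluded by strict
    monotonicity if l > 0, and by constancy on [-1, 0] if l = 0. *)
Lemma optimum_of_sign_change :
  0 < a_c M N (dP M N) -> a_c M N (dP_pred M N) < 0 ->
     exists d : \bar R,
       ((d < +oo)%E /\ is_dSc M N d)
       /\ ((dP M N < d)%E /\ (d <= dP_pred M N)%E /\ a_c M N d = 0)
       /\ (forall d' : \bar R,
             (dP M N < d')%E -> (d' <= dP_pred M N)%E ->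
             a_c M N d' = 0 -> d' = d).
Proof.
rewrite !dP_predE => alo ahi.
have [x [x0 lox ax xhi]] : exists x, [/\ 0 <= x, (dP M N < x%:E)%E \/ dP M N = x%:E,
    0 <= a_c_fin M N x & (x%:E <= dP M N.-1)%E].
  case: lo_cases => [lo|[z [z0 _ lo]]].
    exists 0; split; [exact: lexx|by left; rewrite lo lte_fin ltrN10| |exact: dP_pred_ge0].
    by apply: a_c_fin0_ge0 => n nN; rewrite -lee_fin -B_utility//; exact: B0_ge0.
  exists z; split; [exact: z0|by right| |by rewrite -lo ltW// dP_lt_pred].
  by move: alo; rewrite lo; exact: ltW.
have [y [xy ay yhi]] : exists y, [/\ x <= y, a_c_fin M N y <= 0 & (y%:E <= dP M N.-1)%E].
  case: (dP M N.-1) dP_pred_ge0 xhi ahi => [z| |] // hi0 xhi ahi.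
    by exists z; split; [move: xhi; rewrite lee_fin|exact: ltW|exact: lexx].
  have [y xy ay] := a_c_fin_eventually_lt0 x.
  by exists y; split; [exact: xy|exact: ltW|exact: leey].
have [w /andP[xw wy] aw] := a_c_fin_zero x0 xy ax ay.
have w0 : 0 <= w := le_trans x0 xw.
have low : (dP M N < w%:E)%E.
  case: lox => [lox|lox]; first by rewrite (lt_le_trans lox)// lee_fin.
  rewrite lox lte_fin lt_neqAle xw andbT; apply/eqP => xEw.
  by move: alo; rewrite lox xEw /= aw ltxx.
have whi : (w%:E <= dP M N.-1)%E by rewrite (le_trans _ yhi)// lee_fin.
have fw : feasible M N w%:E by apply/feasibleP.
exists w%:E; split; last split.
- split; first exact: ltry.
  by apply: (sign_change_is_dSc fw) => d' _ _; rewrite /= aw lexx.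
- by split; [exact: low|split; [exact: whi|exact: aw]].
move=> [u| |] lou uhi au.
- congr _%:E.
  have au0 : a_c_fin M N u = 0 by exact: au.
  have u_ok : 0 < l \/ 0 <= u.
    have [l0|l0] := ltP 0 l; [by left|right].
    have {}l0 : l = 0 by apply/eqP; rewrite eq_le l0.
    rewrite leNgt; apply/negP => u0.
    have lo1 : dP M N = (-1)%:E by case: lo_cases => // -[z [_]]; rewrite l0 ltxx.
    have : 0 < a_c_fin M N (-1) by move: alo; rewrite lo1.
    rewrite (a_c_fin_const l0 (lerN10 R)).
    by rewrite -(a_c_fin_const l0 (ltW u0)) au0 ltxx.
  have w_ok : 0 < l \/ 0 <= w by right.
  apply/eqP; rewrite eq_le !leNgt; apply/andP; split; apply/negP => uw.
    by have := a_c_fin_decr w_ok uw; rewrite aw au0 ltxx.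
  by have := a_c_fin_decr u_ok uw; rewrite aw au0 ltxx.
- by move: (a_c_infty_lt0); rewrite au ltxx.
- by move: lou; rewrite ltNge leNye.
Qed.

End Quotes.

Theorem proposition8 (R : realType) (M : model R)
  (lam_gt0 : 0 < lam M) (mu_gt0 : 0 < mu M)
  (cwait_gt0 : 0 < cwait M) (risk_gt0 : 0 < risk M)
  (fee_ge0 : 0 <= fee M) (fee_le : fee M <= reward M)
  (lcomp_ge0 : 0 <= lcomp M) (lcomp_le : lcomp M <= cwait M)
  (nondegenerate : lcomp M < cwait M \/ fee M < reward M)
  (n0 : nat) (n0_gt0 : (0 < n0)%N)
  (n0_low : (onat_ereal R (nlow M) <= n0%:R%:E)%E)
  (n0_high : (n0%:R%:E <= onat_ereal R (nhigh M))%E) :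
  (a_c M n0 (dP M n0) <= 0 ->
     (nhigh M = Some n0 /\ is_dSc M n0 0%E)
     \/ ((forall d : \bar R, ~ optimal M n0 d)
         /\ (forall d : \bar R,
               (0 <= d)%E -> (dP M n0 < d)%E -> (d <= dP_pred M n0)%E ->
               Sc M d <> Zc M n0)
         /\ eps_optimal_exist M n0))
  /\
  (0 <= a_c M n0 (dP_pred M n0) ->
     (dP_pred M n0 < +oo)%E
     /\ optimal M n0 (dP_pred M n0)
     /\ (forall d : \bar R, optimal M n0 d -> d = dP_pred M n0))
  /\
  (0 < a_c M n0 (dP M n0) -> a_c M n0 (dP_pred M n0) < 0 ->
     exists d : \bar R,
       ((d < +oo)%E /\ is_dSc M n0 d)
       /\ ((dP M n0 < d)%E /\ (d <= dP_pred M n0)%E /\ a_c M n0 d = 0)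
       /\ (forall d' : \bar R,
             (dP M n0 < d')%E -> (d' <= dP_pred M n0)%E ->
             a_c M n0 d' = 0 -> d' = d)).
Proof.
have v_gt0 := vrate_gt0_of_nhigh mu_gt0 risk_gt0 n0_gt0 n0_high.
split; last split.
- exact: (optimum_of_nonpositive_at_dP mu_gt0 risk_gt0 v_gt0
    cwait_gt0 lcomp_ge0 lcomp_le lam_gt0 n0_gt0 n0_low n0_high nondegenerate).
- exact: (optimum_of_nonnegative_at_dP_pred mu_gt0 risk_gt0 v_gt0
    cwait_gt0 lcomp_ge0 lcomp_le lam_gt0 n0_gt0 n0_low n0_high nondegenerate).
- exact: (optimum_of_sign_change mu_gt0 risk_gt0 v_gt0
    cwait_gt0 lcomp_ge0 lcomp_le lam_gt0 n0_gt0 n0_low n0_high nondegenerate).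
Qed.
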